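(* Let $m$ and $n$ be positive integers. The number of centered lozenge tilings of a semiregular hexagon with side lengths $2n,\,2n,\,2m-1$ equals $Q(m,n)\,P(2n,2n,2m-1)$, where $$Q(m,n)=\frac{(2n)!^2\,(2m)!\,(m+2n-1)!}{2\cdot n!^2\,m!\,(2m+4n-2)!}\sum_{i=0}^{n-1}\frac{(-1)^{n-i-1}}{2n-2i-1}\,\frac{(m+n-i)_{2i}}{i!^2}$$ and $$P(a,b,c)=\prod_{i=1}^{a}\prod_{j=1}^{b}\prod_{k=1}^{c}\frac{i+j+k-1}{i+j+k-2}.$$
   Context: Work in the tiling of the plane by unit equilateral triangles. A semiregular hexagon with side lengths $a,b,c$ is a hexagon made of unit triangles, with all angles $120^\circ$ and consecutive sides of lengths $a,b,c,a,b,c$. A lozenge is a rhombus of unit side with angles $60^\circ$ and $120^\circ$, i.e. the union of two unit triangles sharing an edge; a lozenge tiling of a region is a tiling of it by lozenges. $P(a,b,c)$ is the total number of lozenge tilings of the semiregular hexagon with sides $a,b,c$ (MacMahon's product above). For a semiregular hexagon with sides $a,a,b$ where $a$ and $b$ have opposite parity, the center of the hexagon is the center of a unique lozenge of the lattice (the two unit triangles sharing the lattice edge through the center), called the central lozenge; a lozenge tiling is centered if it contains the central lozenge as one of its tiles. The shifted factorial is $(x)_k=x(x+1)\cdots(x+k-1)$ for $k\ge1$, $(x)_0=1$. *)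

(* Defs.v *)
From mathcomp Require Import all_boot all_order all_algebra.

Set Implicit Arguments.
Unset Strict Implicit.
Unset Printing Implicit Defensive.

Import Order.TTheory GRing.Theory Num.Theory.

Local Open Scope nat_scope.

(* Points of the triangular lattice are written (x, y), meaning x e1 + y e2   *)
(* for unit vectors e1, e2 at an angle of 60 degrees; the third direction of  *)
(* lattice lines is e2 - e1.                                                  *)
Definition point : Type := (nat * nat)%type.

(* The unit cell with lower left corner (x, y) is cut by the segment from     *)
(* (x + 1, y) to (x, y + 1) into two unit triangles; the boolean selects the  *)
(* one containing (x, y) (true) or the one containing (x + 1, y + 1) (false). *)
(* Only the cells of a p by q parallelogram are represented.                  *)
Definition triangle (p q : nat) : Type := ('I_p * 'I_q * bool)%type.

Definition vertices (p q : nat) (t : triangle p q) : seq point :=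
  let: (x, y, lower) := t in
  [:: (if lower then (x : nat, y : nat) else (x.+1, y.+1));
      (x.+1, y : nat); (x : nat, y.+1)].

Definition common_vertices (p q : nat) (s t : triangle p q) : seq point :=
  [seq v <- vertices s | v \in vertices t].

Definition share_edge (p q : nat) (s t : triangle p q) : bool :=
  size (common_vertices s t) == 2.

Definition is_lozenge (p q : nat) (L : {set triangle p q}) : bool :=
  [exists s, exists t, (L == [set s; t]) && share_edge s t].

(* The center of a lozenge is the midpoint of the edge shared by its two      *)
(* triangles, so (X, Y) below is twice the center.                            *)
Definition is_lozenge_with_center2 (p q : nat) (XY : point)
    (L : {set triangle p q}) : bool :=
  [exists s, exists t,
    [&& L == [set s; t], share_edge s t,
        \sum_(v <- common_vertices s t) v.1 == XY.1 &
        \sum_(v <- common_vertices s t) v.2 == XY.2]].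

(* The closed hexagon with corners, in cyclic order,                          *)
(*   (c, 0), (a + c, 0), (a + c, b), (a, b + c), (0, b + c), (0, c);          *)
(* consecutive corners differ by a e1, b e2, c (e2 - e1), - a e1, - b e2 and  *)
(* - c (e2 - e1), so the sides are a, b, c, a, b, c and the angles 120        *)
(* degrees.                                                                   *)
Definition in_hexagon (a b c : nat) (v : point) : bool :=
  [&& v.1 <= a + c, v.2 <= b + c & c <= v.1 + v.2 <= a + b + c].

Definition hexagon (a b c : nat) : {set triangle (a + c) (b + c)} :=
  [set t | all (in_hexagon a b c) (vertices t)].

(* The hexagon is symmetric under (x, y) |-> (a + c - x, b + c - y), so this  *)
(* is twice its center.                                                       *)
Definition hexagon_center2 (a b c : nat) : point := (a + c, b + c).

Definition is_lozenge_tiling (a b c : nat)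
    (T : {set {set triangle (a + c) (b + c)}}) : bool :=
  partition T (hexagon a b c) && [forall L in T, is_lozenge L].

(* If a = b and c has the opposite parity, there is exactly one lozenge of    *)
(* the lattice with the same center as the hexagon.                           *)
Definition is_centered (a b c : nat)
    (T : {set {set triangle (a + c) (b + c)}}) : bool :=
  [exists L in T, is_lozenge_with_center2 (hexagon_center2 a b c) L].

Definition num_centered_tilings (a b c : nat) : nat :=
  #|[set T : {set {set triangle (a + c) (b + c)}} |
      is_lozenge_tiling T && is_centered T]|.

Local Open Scope ring_scope.

Definition shifted_factorial (x : rat) (k : nat) : rat :=
  \prod_(j < k) (x + j%:R).

Definition P (a b c : nat) : rat :=
  \prod_(1 <= i < a.+1) \prod_(1 <= j < b.+1) \prod_(1 <= k < c.+1)
    (((i + j + k)%:R - 1) / ((i + j + k)%:R - 2)).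

(* All natural number subtractions below are exact for m, n > 0 and i < n.    *)
Definition Q (m n : nat) : rat :=
  (((2 * n)`! ^ 2 * (2 * m)`! * (m + 2 * n - 1)`!)%N)%:R
  / ((2 * n`! ^ 2 * m`! * (2 * m + 4 * n - 2)`!)%N)%:R
  * \sum_(0 <= i < n)
      (-1) ^+ (n - i - 1) / (2 * n - 2 * i - 1)%:R
      * (shifted_factorial (m + n - i)%:R (2 * i) / (i`! ^ 2)%:R).

(* Main.v *)
(* Slice the hexagon with sides a, a, c by the lattice lines x + y = s.  Of    *)
(* the a + c unit segments of the middle line exactly a are crossed by         *)
(* lozenges; if these form the set S, each half of the hexagon has             *)
(* det ('C(s, j)) (s in S, j < a) tilings: removing the strip along the middle *)
(* line replaces S by the sets interlacing it, which amounts to taking         *)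
(* differences of consecutive rows of the determinant.  So tilings are counted *)
(* by squared Vandermonde determinants, that is, by the orthogonal polynomial  *)
(* ensemble of the uniform weight on {0, ..., a + c - 1}, and by Andreief's    *)
(* identity the proportion of tilings with mid in S is the sum over k < a of   *)
(* p_k(mid)^2 / |p_k|^2, where the p_k are the discrete Chebyshev polynomials. *)
(* The odd p_k vanish at mid, the three term recurrence gives the value of the *)
(* even ones, and the sum is matched with Q by creative telescoping in n for   *)
(* fixed m + n.                                                                *)

Require Import Defs.
From mathcomp Require Import all_boot all_order all_fingroup all_algebra.
From mathcomp Require Import zify ring lra.

Set Implicit Arguments.
Unset Strict Implicit.
Unset Printing Implicit Defensive.

Import Order.TTheory GRing.Theory Num.Theory.

(** * Perfect matchings of a finite graph *)

(** A tiling is a perfect matching of the adjacency graph of the unit triangles. The lattice line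
    [x + y = N], with [N = a + c], cuts the hexagon into two mirror halves. Once the set [S] of
    segments of this line crossed by lozenges is fixed, the halves are tiled independently, so [S]
    contributes the square of the count for one half; centered means that [S] contains the middle
    segment [mid] ([num_centered_tilingsE]).

    Peeling off strips shows that a half has [det ('C(s, j))] tilings, with s in [S], if [S] has a
    elements and none otherwise ([num_matchings_strips]). Up to a product of factorials this is a
    Vandermonde determinant, in which any monic polynomials [p_k] of degree k may replace the
    powers. For [p_k] orthogonal with respect to the uniform weight on {0, ..., N - 1}, summing the
    squared determinants over the sets containing [mid] gives the product of the [|p_k|^2] times the
    sum over k < a of [p_k(mid)^2 / |p_k|^2] ([sum_sample_det_marked]). Divided by the squared
    factorials, the product of norms is exactly [P a a c] ([MacMahon_gram]), so the sum has to be
    identified with [Q] ([num_centered_tilings_cheb]).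

    The [p_k] are the discrete Chebyshev polynomials [cheb], given by a Rodrigues formula. Their
    centre of symmetry is [mid]: odd degrees vanish there, and the three term recurrence gives the
    even ones in closed form ([cheb_center]). The summands of [Q] are not these terms one by one;
    but raising n and lowering m by one adds exactly one [center_term] to [Q] ([Q_step]), by a
    creative telescoping recurrence for its sum ([QsumS]). *)

Section PerfectMatchings.
Variables (V : finType) (e : rel V).
Hypotheses (e_sym : symmetric e) (e_irr : irreflexive e).

Definition is_edge (L : {set V}) : bool :=
  [exists s, exists t, (L == [set s; t]) && e s t].

Definition matching (D : {set V}) (T : {set {set V}}) : bool :=
  partition T D && [forall L in T, is_edge L].

Definition num_matchings (D : {set V}) : nat := #|[set T | matching D T]|.

Lemma is_edgeP (L : {set V}) (v : V) :
  is_edge L -> v \in L -> exists2 w, e v w & L = [set v; w].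
Proof.
case/existsP=> s /existsP[t /andP[/eqP-> st]]; rewrite !inE.
by case/orP=> /eqP->; [exists t | exists s; rewrite 1?e_sym // setUC].
Qed.

Lemma edge_is_edge (s t : V) : e s t -> is_edge [set s; t].
Proof. by move=> st; apply/existsP; exists s; apply/existsP; exists t; rewrite eqxx. Qed.

Lemma pair_inj (v w w' : V) : e v w' -> [set v; w] = [set v; w'] -> w = w'.
Proof.
move=> vw' eqw; have: w' \in [set v; w] by rewrite eqw !inE eqxx orbT.
rewrite !inE => /orP[] /eqP // w'v; by rewrite w'v e_irr in vw'.
Qed.

Lemma matching_is_edge (D : {set V}) (T : {set {set V}}) (L : {set V}) :
  matching D T -> L \in T -> is_edge L.
Proof. by case/andP=> _ /forall_inP; apply. Qed.

Lemma matching_partner (D : {set V}) (T : {set {set V}}) (v : V) :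
  matching D T -> v \in D -> exists w, [/\ w \in D, e v w & [set v; w] \in T].
Proof.
move=> mT vD; case/andP: (mT) => pT _.
have vc : v \in cover T by rewrite (cover_partition pT).
have bT := pblock_mem vc.
have [||w vw bE] := @is_edgeP (pblock T v) v; rewrite ?mem_pblock //.
  exact: matching_is_edge mT bT.
exists w; rewrite -bE; split=> //.
by rewrite -(cover_partition pT); apply/bigcupP; exists (pblock T v); rewrite // bE !inE eqxx orbT.
Qed.

Lemma matching_partner_uniq (D : {set V}) (T : {set {set V}}) (v w w' : V) :
  matching D T -> e v w' -> [set v; w] \in T -> [set v; w'] \in T -> w = w'.
Proof.
move=> /andP[pT _] vw' wT w'T; apply: (pair_inj vw').
have tT := partition_trivIset pT.
by rewrite -(def_pblock tT wT (x := v)) -1?(def_pblock tT w'T (x := v)) // !inE eqxx.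
Qed.

Lemma matchingD1 (D L : {set V}) (T : {set {set V}}) :
  L \in T -> matching D T -> matching (D :\: L) (T :\ L).
Proof.
move=> LT /andP[pT /forall_inP eT]; rewrite /matching partitionD1 //=.
by apply/forall_inP=> L' /setD1P[_ /eT].
Qed.

Lemma matchingU (D1 D2 : {set V}) (T1 T2 : {set {set V}}) :
  [disjoint D1 & D2] -> matching D1 T1 -> matching D2 T2 ->
  matching (D1 :|: D2) (T1 :|: T2).
Proof.
move=> dD /andP[/and3P[/eqP c1 t1 z1] /forall_inP e1].
move=> /andP[/and3P[/eqP c2 t2 z2] /forall_inP e2].
apply/andP; split; last by apply/forall_inP=> L /setUP[/e1|/e2].
rewrite /partition inE negb_or z1 z2 /cover bigcup_setU -!/(cover _) c1 c2 eqxx.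
by rewrite trivIsetU ?c1 ?c2.
Qed.

Lemma matching1 (v w : V) : e v w -> matching [set v; w] [set [set v; w]].
Proof.
move=> vw; apply/andP; split; last by apply/forall_inP=> L /set1P ->; apply: edge_is_edge.
rewrite /partition /cover big_set1 eqxx trivIset1 inE /= eq_sym.
by apply/set0Pn; exists v; rewrite !inE eqxx.
Qed.

Lemma num_matchings0 : num_matchings set0 = 1.
Proof.
apply/eqP/cards1P; exists set0; apply/setP=> T; rewrite !inE /matching partition_set0.
by case: eqP => //= ->; apply/forall_inP=> L; rewrite inE.
Qed.

Lemma num_matchings_edge (D : {set V}) (v w : V) :
  v \in D -> w \in D -> e v w ->
  #|[set T | matching D T & [set v; w] \in T]| = num_matchings (D :\: [set v; w]).
Proof.
move=> vD wD vw; set L := [set v; w].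
have sLD : L \subset D by rewrite subUset !sub1set vD.
have nL (T : {set {set V}}) : matching (D :\: L) T -> L \notin T.
  case/andP=> pT _; apply/negP=> /(partitionS pT)/subsetP/(_ v).
  by rewrite !inE eqxx; move/(_ isT).
rewrite -(card_in_imset (f := fun T => T :\ L)); last first.
  move=> T T'; rewrite !inE => /andP[_ LT] /andP[_ LT'] /(congr1 (fun X => L |: X)).
  by rewrite !setD1K.
rewrite /num_matchings; congr #|pred_of_set _|; apply/setP=> T.
rewrite [in RHS]inE; apply/imsetP/idP => [[T']|mT].
  by rewrite inE => /andP[mT' LT'] ->; apply: matchingD1.
exists (L |: T); last by rewrite setU1K ?nL.
rewrite inE setU11 andbT -(setID D L) (setIidPr sLD).
apply: matchingU => //; last exact: matching1.
by rewrite disjoints_subset; apply/subsetP=> x; rewrite !inE => ->.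
Qed.

(** Each matching is counted once on the right, at the unique partner of [v]. *)
Lemma num_matchings_expand (D : {set V}) (v : V) : v \in D ->
  num_matchings D = \sum_(w in D | e v w) num_matchings (D :\: [set v; w]).
Proof.
move=> vD; rewrite /num_matchings.
under eq_bigr => w /andP[wD vw].
  rewrite -/(num_matchings _) -num_matchings_edge // -sum1_card.
  under eq_bigl => T do rewrite inE.
  rewrite big_mkcondr; over.
rewrite exchange_big /= -sum1_card; under eq_bigl => T do rewrite inE.
apply: eq_bigr => T mT.
have [w [wD vw wT]] := matching_partner mT vD.
rewrite (bigD1 w) ?wD //= wT big1 // => w' /andP[/andP[_ vw'] ne].
case: ifP => // w'T; case/eqP: ne.
exact: (matching_partner_uniq mT vw w'T wT).
Qed.

Lemma num_matchings_isolated (D : {set V}) (v : V) :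
  v \in D -> (forall w, w \in D -> ~~ e v w) -> num_matchings D = 0.
Proof.
move=> vD iso; rewrite (num_matchings_expand vD) big1 // => w /andP[wD vw].
by move: (iso w wD); rewrite vw.
Qed.

Lemma num_matchings_forced (D : {set V}) (v w : V) :
  v \in D -> w \in D -> e v w -> (forall w', w' \in D -> e v w' -> w' = w) ->
  num_matchings D = num_matchings (D :\: [set v; w]).
Proof.
move=> vD wD vw uniq_w; rewrite (num_matchings_expand vD) (bigD1 w) ?wD //=.
by rewrite big1 ?addn0 // => w' /andP[/andP[w'D /uniq_w->]] //; rewrite eqxx.
Qed.

Lemma num_matchings_expand2 (D : {set V}) (v w1 w2 : V) :
  v \in D -> w1 != w2 -> (forall w, w \in D -> e v w -> w = w1 \/ w = w2) ->
  num_matchings D =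
    ((w1 \in D) && e v w1) * num_matchings (D :\: [set v; w1]) +
    ((w2 \in D) && e v w2) * num_matchings (D :\: [set v; w2]).
Proof.
move=> vD w12 only; rewrite (num_matchings_expand vD) big_mkcond /=.
rewrite (bigD1 w1) //= (bigD1 w2) ?[w2 == _]eq_sym //= big1; last first.
  move=> w /andP[n1 n2]; case: ifP => // /andP[wD vw].
  by case: (only w wD vw) => wE; rewrite wE eqxx in n1 n2.
by rewrite addn0; congr (_ + _); case: ifP => _; rewrite ?mul1n ?mul0n.
Qed.

Lemma num_matchings_imset (g : V -> V) (D : {set V}) :
  injective g -> (forall s t, e (g s) (g t) = e s t) ->
  num_matchings (g @: D) = num_matchings D.
Proof.
move=> g_inj g_e; have gs_inj := imset_inj g_inj.
have [h hK gK] : bijective g by exact: injF_bij.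
have gE (L : {set V}) : is_edge (g @: L) = is_edge L.
  apply/existsP/existsP=> [] [s /existsP[t /andP[/eqP LE st]]].
    exists (h s); apply/existsP; exists (h t); rewrite -g_e !gK st andbT.
    by apply/eqP/gs_inj; rewrite LE imsetU !imset_set1 !gK.
  exists (g s); apply/existsP; exists (g t); rewrite g_e st andbT.
  by rewrite LE imsetU !imset_set1.
have gM (D' : {set V}) (T : {set {set V}}) :
    matching (g @: D') [set g @: (L : {set V}) | L in T] = matching D' T.
  rewrite /matching imset_partition //; congr andb.
  apply/forall_inP/forall_inP=> eT L.
    by move=> LT; rewrite -gE; apply/eT/imset_f.
  by case/imsetP=> L' L'T ->; rewrite gE eT.
rewrite /num_matchings -[RHS](card_imset _ (imset_inj gs_inj)); congr #|pred_of_set _|.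
apply/setP=> T; rewrite inE; apply/idP/imsetP=> [mT|[T']]; last first.
  by rewrite inE => mT' ->; rewrite gM.
have TE : T = [set g @: (L : {set V}) | L in [set h @: (L : {set V}) | L in T]].
  rewrite -imset_comp -[LHS]imset_id; apply: eq_imset => L /=.
  by rewrite -imset_comp -[LHS]imset_id; apply: eq_imset => x /=; rewrite gK.
by exists [set h @: (L : {set V}) | L in T]; rewrite // inE -gM -TE.
Qed.

(** * Matchings of two regions joined by disjoint edges *)

Section Cut.
Variables (I : finType) (u v : I -> V) (D1 D2 : {set V}).
Hypotheses (u_inj : injective u) (v_inj : injective v).
Hypotheses (uD : forall i, u i \in D1) (vD : forall i, v i \in D2).
Hypotheses (dD : [disjoint D1 & D2]) (uv : forall i, e (u i) (v i)).
Hypothesis cross : forall s t, s \in D1 -> t \in D2 -> e s t ->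
  exists2 i, s = u i & t = v i.

Let bridge (S : {set I}) := [set [set u i; v i] | i in S].

Let D12 x : x \in D1 -> x \in D2 = false.
Proof. exact: (disjointFr dD). Qed.

Let matching_bridge (S : {set I}) : matching (u @: S :|: v @: S) (bridge S).
Proof.
rewrite /matching /partition; apply/andP; split; first apply/and3P; first split.
- apply/eqP/setP=> x; rewrite cover_imset; apply/bigcupP/setUP => [[i iS]|].
    by rewrite !inE => /orP[] /eqP ->; [left | right]; rewrite imset_f.
  by case=> /imsetP[i iS ->]; exists i; rewrite // !inE eqxx ?orbT.
- apply/trivIsetP=> _ _ /imsetP[i iS ->] /imsetP[j jS ->] ne.
  have {ne} ij : i != j by apply: contraNneq ne => ->.
  rewrite -setI_eq0; apply/eqP/setP=> x; rewrite !inE; apply/negbTE/negP.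
  have uvF k l : (u k == v l) = false.
    by apply/negbTE; apply: contraTneq (vD l) => <-; rewrite D12.
  case/andP=> /orP[] /eqP-> /orP[];
   rewrite ?(inj_eq u_inj) ?(inj_eq v_inj) ?(negPf ij) ?uvF 1?[_ == _]eq_sym ?uvF //.
- apply/imsetP=> [[i _ /setP/(_ (u i))]].
  by rewrite !inE eqxx.
- by apply/forall_inP=> _ /imsetP[i _ ->]; apply: edge_is_edge.
Qed.

(** By [cross] an edge between the two sides is a bridge. Deleting the bridges used leaves a
    matching of each side minus the bridge ends, and the two can be chosen independently. *)
Lemma num_matchings_cut (S : {set I}) :
  #|[set T | matching (D1 :|: D2) T & [set i | [set u i; v i] \in T] == S]|
    = num_matchings (D1 :\: u @: S) * num_matchings (D2 :\: v @: S).
Proof.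
rewrite /num_matchings -cardsX.
(* [join] glues a pair of matchings along the bridges of [S]; the two maps [side] recover the pair,
   so [join] is injective and only its image has to be found. *)
pose join (p : {set {set V}} * {set {set V}}) := p.1 :|: p.2 :|: bridge S.
pose side (D : {set V}) (T : {set {set V}}) := [set L in T | L \subset D].
have sideE p : p \in setX [set T | matching (D1 :\: u @: S) T]
                          [set T | matching (D2 :\: v @: S) T] ->
    side D1 (join p) = p.1 /\ side D2 (join p) = p.2.
  rewrite !inE => /andP[/andP[m1 _] /andP[m2 _]].
  have sub1 L : L \in p.1 -> L \subset D1.
    by move=> /(partitionS m1) /subset_trans; apply; apply: subsetDl.
  have sub2 L : L \in p.2 -> L \subset D2.
    by move=> /(partitionS m2) /subset_trans; apply; apply: subsetDl.
  have nsub L : L != set0 -> L \subset D1 -> L \subset D2 -> False.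
    case/set0Pn=> x xL /subsetP/(_ x xL) x1 /subsetP/(_ x xL).
    by rewrite D12.
  split; apply/setP=> L; rewrite !inE.
    apply/andP/idP => [[/orP[/orP[]|]]|L1] //; last by rewrite L1 sub1.
      move=> L2 L1; case: (nsub L) => //; [exact: partition_neq0 m2 L2 | exact: sub2].
    case/imsetP=> i _ -> /subsetP/(_ (v i)); rewrite !inE eqxx orbT => /(_ isT).
    by move/D12; rewrite vD.
  apply/andP/idP => [[/orP[/orP[]|]]|L2] //; last by rewrite L2 orbT sub2.
    move=> L1 L2; case: (nsub L) => //; [exact: partition_neq0 m1 L1 | exact: sub1].
  case/imsetP=> i _ -> /subsetP/(_ (u i)); rewrite !inE eqxx => /(_ isT).
  by rewrite D12 ?uD.
rewrite -(card_in_imset (f := join)); last first.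
  move=> p q /sideE[E1 E2] /sideE[E3 E4] eqj.
  by rewrite [p]surjective_pairing [q]surjective_pairing -E1 -E2 -E3 -E4 eqj.
congr #|pred_of_set _|; apply/setP=> T; rewrite inE; apply/andP/imsetP.
  case=> mT /eqP SE; have tT : trivIset T by case/andP: mT => /partition_trivIset.
  have sSE i : (i \in S) = ([set u i; v i] \in T) by rewrite -SE inE.
  have m1 : matching (D1 :\: u @: S) (side D1 T).
    rewrite /matching /partition; apply/andP; split; first apply/and3P; first split.
    - apply/eqP/setP=> x; apply/bigcupP/setDP => [[L]|[x1 xS]].
        rewrite inE => /andP[LT L1] xL; rewrite (subsetP L1) //; split=> //.
        apply/imsetP=> [[i iS xE]]; rewrite sSE in iS.
        have/(congr1 (fun X : {set V} => v i \in X)) : [set u i; v i] = L.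
          by rewrite -(def_pblock tT iS (x := x)) ?(def_pblock tT LT) // xE !inE eqxx.
        rewrite !inE eqxx orbT => /esym/(subsetP L1)/D12; by rewrite vD.
      have [|w [wD xw wT]] := @matching_partner _ T x mT; first by rewrite inE x1.
      exists [set x; w]; last by rewrite !inE eqxx.
      rewrite inE wT subUset !sub1set x1 /=; case/setUP: wD => // w2.
      have [i xE wE] := cross x1 w2 xw; case/imsetP: xS.
      by exists i; rewrite // sSE -xE -wE.
    - by apply: trivIsetS tT; apply/subsetP=> L; rewrite inE => /andP[].
    - rewrite inE; case/andP: mT => /partition0 -> _ //.
    - by apply/forall_inP=> L; rewrite inE => /andP[LT _]; apply: matching_is_edge mT LT.
  have m2 : matching (D2 :\: v @: S) (side D2 T).
    rewrite /matching /partition; apply/andP; split; first apply/and3P; first split.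
    - apply/eqP/setP=> x; apply/bigcupP/setDP => [[L]|[x1 xS]].
        rewrite inE => /andP[LT L1] xL; rewrite (subsetP L1) //; split=> //.
        apply/imsetP=> [[i iS xE]]; rewrite sSE in iS.
        have/(congr1 (fun X : {set V} => u i \in X)) : [set u i; v i] = L.
          by rewrite -(def_pblock tT iS (x := x)) ?(def_pblock tT LT) // xE !inE eqxx orbT.
        by rewrite !inE eqxx => /esym/(subsetP L1); rewrite D12.
      have [|w [wD xw wT]] := @matching_partner _ T x mT; first by rewrite inE x1 orbT.
      exists [set x; w]; last by rewrite !inE eqxx.
      rewrite inE wT subUset !sub1set x1 /=; case/setUP: wD => // w2.
      rewrite e_sym in xw; have [i wE xE] := cross w2 x1 xw; case/imsetP: xS.
      by exists i; rewrite // sSE -xE -wE setUC.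
    - by apply: trivIsetS tT; apply/subsetP=> L; rewrite inE => /andP[].
    - rewrite inE; case/andP: mT => /partition0 -> _ //.
    - by apply/forall_inP=> L; rewrite inE => /andP[LT _]; apply: matching_is_edge mT LT.
  exists (side D1 T, side D2 T); first by rewrite !inE m1.
  apply/setP=> L; rewrite !inE /=; apply/idP/idP => [LT|]; last first.
    by case/orP=> [/orP[]/andP[]//|/imsetP[i]]; rewrite sSE => iT ->.
  rewrite LT /=; have /existsP[s /existsP[t /andP[/eqP LE st]]] := matching_is_edge mT LT.
  have LD : L \subset D1 :|: D2 by case/andP: mT => /partitionS/(_ LT).
  have sD : s \in D1 :|: D2 by apply: (subsetP LD); rewrite LE !inE eqxx.
  have tD : t \in D1 :|: D2 by apply: (subsetP LD); rewrite LE !inE eqxx orbT.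
  case/setUP: sD => sD; case/setUP: tD => tD.
  - by rewrite {1}LE subUset !sub1set sD tD.
  - have [i sE tE] := cross sD tD st; apply/orP; right; apply/imsetP; exists i.
      by rewrite sSE -sE -tE -LE.
    by rewrite LE sE tE.
  - rewrite e_sym in st; have [i tE sE] := cross tD sD st.
    apply/orP; right; apply/imsetP; exists i; rewrite ?sSE.
      by rewrite -sE -tE setUC -LE.
    by rewrite LE sE tE setUC.
  - by rewrite {2}LE subUset !sub1set sD tD orbT.
case=> p pM TE; have [s1 s2] := sideE p pM.
move: pM; rewrite !inE => /andP[m1 m2].
have DE : D1 :|: D2 = (D1 :\: u @: S) :|: (D2 :\: v @: S) :|: (u @: S :|: v @: S).
  apply/setP=> x; rewrite !inE.
  have: x \in u @: S -> x \in D1 by case/imsetP=> i _ ->.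
  have: x \in v @: S -> x \in D2 by case/imsetP=> i _ ->.
  by case: (x \in u @: S); case: (x \in v @: S); case: (x \in D1); case: (x \in D2) => // A B;
    try (by have := A isT); try (by have := B isT).
have uvdisj : forall x, x \in u @: S -> x \in D1 /\ x \in v @: S = false.
  move=> _ /imsetP[i iS ->]; rewrite uD; split=> //; apply/imsetP=> [[j _ uE]].
  by have := vD j; rewrite -uE D12.
split.
  rewrite TE DE; apply: matchingU; last exact: matching_bridge.
    rewrite disjoints_subset; apply/subsetP=> x; rewrite !inE negb_or.
    case/orP=> /andP[nx xD].
      rewrite nx; apply/imsetP=> [[j _ xE]]; by have := D12 xD; rewrite xE vD.
    rewrite nx andbT; apply/imsetP=> [[j _ xE]].
    by move: xD; rewrite xE D12.
  apply: matchingU => //; rewrite disjoints_subset; apply/subsetP=> x; rewrite !inE.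
  by case/andP=> _ /D12 ->; rewrite andbF.
apply/eqP/setP=> i; rewrite inE TE /join !inE; apply/orP/idP => [[/orP[]|]|iS].
- rewrite -s1 inE => /andP[_ /subsetP/(_ (v i))]; rewrite !inE eqxx orbT => /(_ isT)/D12.
  by rewrite vD.
- rewrite -s2 inE => /andP[_ /subsetP/(_ (u i))]; rewrite !inE eqxx => /(_ isT).
  by rewrite D12.
- case/imsetP=> j jS /setP/(_ (u i)); rewrite !inE eqxx (inj_eq u_inj) => /esym/orP[/eqP->//|].
  by move=> /eqP uE; have := vD j; rewrite -uE D12.
- by right; apply/imsetP; exists i.
Qed.

End Cut.
End PerfectMatchings.

(** * Tilings of strips *)

(* The lower triangle of the cell (x, y) shares an edge with the upper         *)
(* triangle of the cell (x', y').                                              *)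
Definition facing (x y x' y' : nat) : bool :=
  [|| (x' == x) && (y' == y), (x'.+1 == x) && (y' == y) | (x' == x) && (y'.+1 == y)].

Lemma share_edge_low_up (p q : nat) (x x' : 'I_p) (y y' : 'I_q) :
  share_edge (x, y, true) (x', y', false) = facing x y x' y'.
Proof.
rewrite /share_edge /common_vertices size_filter /= !inE /= !xpair_eqE /facing.
case: x x' y y' => [x _] [x' _] [y _] [y' _] /=.
by do ![case: eqP => ? /=; try (exfalso; lia)].
Qed.

Lemma vertices_uniq (p q : nat) (t : triangle p q) : uniq (vertices t).
Proof.
case: t => [[x y] []] /=; rewrite !inE !xpair_eqE /=.
all: by do ![case: eqP => /= ?; try (exfalso; lia)].
Qed.

Lemma common_vertices_sym (p q : nat) (s t : triangle p q) :
  perm_eq (common_vertices s t) (common_vertices t s).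
Proof.
apply: uniq_perm; rewrite ?filter_uniq ?vertices_uniq // => v.
by rewrite !mem_filter andbC.
Qed.

Lemma share_edge_sym (p q : nat) : symmetric (@share_edge p q).
Proof. by move=> s t; rewrite /share_edge (perm_size (common_vertices_sym s t)). Qed.

Lemma share_edge_same (p q : nat) (x x' : 'I_p) (y y' : 'I_q) (b : bool) :
  share_edge (x, y, b) (x', y', b) = false.
Proof.
rewrite /share_edge /common_vertices size_filter.
case: b => /=; rewrite !inE !xpair_eqE /=.
all: by do ![case: eqP => /= ?; try (exfalso; lia)].
Qed.

Lemma share_edge_irr (p q : nat) : irreflexive (@share_edge p q).
Proof. by case=> [[x y] b]; apply: share_edge_same. Qed.

Lemma share_edge_up_low (p q : nat) (x x' : 'I_p) (y y' : 'I_q) :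
  share_edge (x, y, false) (x', y', true) = facing x' y' x y.
Proof. by rewrite share_edge_sym share_edge_low_up. Qed.

Definition region (N : nat) (P : nat -> nat -> bool -> bool) : {set triangle N N} :=
  [set t : triangle N N | P t.1.1 t.1.2 t.2].

(* The strip number s lies between the lines x + y = s and x + y = s + 1; its  *)
(* lower triangles have x + y = s and its upper triangles x + y = s - 1.       *)
(* Below are the strips c, ..., c + k - 1, without the lower triangles of the  *)
(* last one whose abscissas are in A: those are matched across the last line.  *)
Definition strips (N c k : nat) (A : seq nat) : {set triangle N N} :=
  region N (fun i j b =>
    if b then [&& c <= i + j, i + j < c + k & ~~ ((i + j + 1 == c + k) && (i \in A))]
    else (c < i + j + 2) && (i + j + 1 < c + k)).

(* What remains of strips c, ..., c + k when the last strip is matched from    *)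
(* left to right up to abscissa x: A lists the upper triangles of the last     *)
(* strip matched downwards, B its lower triangles matched upwards, and d tells *)
(* whether the upper triangle of abscissa x - 1 still awaits a partner.        *)
Definition partial_strip (N c k x : nat) (d : bool) (A B : seq nat) : {set triangle N N} :=
  region N (fun i j b =>
    if b then [&& c <= i + j, i + j < c + k & ~~ ((i + j + 1 == c + k) && (i \in A))]
           || [&& i + j == c + k, x <= i & i \notin B]
    else (c < i + j + 2) && (i + j + 1 < c + k) || (i + j + 1 == c + k) && (x <= i + d)).

Section PartialStrip.
Variables (N c k : nat).
Hypothesis ck_lt : c + k < N.

Let nm := num_matchings (@share_edge N N).

Lemma partial_strip_start (d : bool) (B : seq nat) :
  partial_strip N c k 0 d [::] B = strips N c k.+1 B.
Proof.
apply/setP=> [[[i j] b]]; rewrite !inE /=.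
case: b; last by lia.
by case: (nat_of_ord i \in B); rewrite /= ?andbF ?andbT; lia.
Qed.

Lemma partial_strip_end (x : nat) (d : bool) (A B : seq nat) : c + k < x ->
  partial_strip N c k x d A B = strips N c k A.
Proof.
move=> lt; apply/setP=> [[[i j] b]]; rewrite !inE /=.
by case: b; case: (nat_of_ord i \in B); case: (nat_of_ord i \in A); rewrite /= ?andbF ?andbT;
  case: d; lia.
Qed.

Lemma partial_strip_drop (x b0 : nat) (d : bool) (A B : seq nat) : b0 < x ->
  partial_strip N c k x d A (b0 :: B) = partial_strip N c k x d A B.
Proof.
move=> lt; apply/setP=> [[[i j] b]]; rewrite !inE /=.
case: b => //; case: (leqP x i) => le; rewrite /= ?andbF //.
by have -> : (nat_of_ord i == b0) = false by lia.
Qed.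

Lemma partial_strip_removed (x : nat) (A B : seq nat) : x \in B ->
  partial_strip N c k x false A B = partial_strip N c k x.+1 true A B.
Proof.
move=> xB; apply/setP=> [[[i j] b]]; rewrite !inE /=.
case: b; last by lia.
congr (_ || _); case: (nat_of_ord i \in B) / boolP => //=; rewrite ?andbF ?andbT // => iB.
have: nat_of_ord i != x by apply: contraNneq iB => ->.
lia.
Qed.

(** With nothing pending, the lower triangle at [x] has lost its left neighbour, so it must take the
    upper triangle of abscissa [x]. *)
Lemma partial_strip_shift (x : nat) (A B : seq nat) : x < c + k -> x \notin B ->
  nm (partial_strip N c k x false A B) = nm (partial_strip N c k x.+1 false A B).
Proof.
move=> lt xB.
have hx : x < N by lia.
have hy : c + k - x < N by lia.
have hy' : c + k - x - 1 < N by lia.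
pose v : triangle N N := (Ordinal hx, Ordinal hy, true).
pose w : triangle N N := (Ordinal hx, Ordinal hy', false).
rewrite /nm (@num_matchings_forced _ _ (@share_edge_sym N N) (@share_edge_irr N N) _ v w).
- congr num_matchings; apply/setP=> [[[i j] b]]; rewrite !inE /= !xpair_eqE -!val_eqE /=.
  case: b; rewrite /= ?andbF ?andbT /=; last by lia.
  by case: (nat_of_ord i \in B) / boolP => iB; case: (nat_of_ord i \in A);
    rewrite /= ?andbF ?andbT; lia.
- by rewrite inE /= xB; lia.
- by rewrite inE /=; lia.
- by rewrite share_edge_low_up /facing /=; lia.
- move=> [[i j] []]; rewrite inE /=; first by rewrite share_edge_same.
  rewrite share_edge_low_up /facing /= => D E; congr (_, _, _); apply: val_inj => /=; lia.
Qed.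

Lemma partial_strip_stuck (A B : seq nat) : c + k \notin B ->
  nm (partial_strip N c k (c + k) false A B) = 0.
Proof.
move=> xB.
have h0 : 0 < N by lia.
apply: (@num_matchings_isolated _ _ (@share_edge_sym N N) (@share_edge_irr N N) _
          (Ordinal ck_lt, Ordinal h0, true)).
  by rewrite inE /= xB; lia.
move=> [[i j] []]; rewrite inE /=; first by rewrite share_edge_same.
rewrite share_edge_low_up /facing /=; lia.
Qed.

(** The pending upper triangle at [x] goes either down, which needs a strip below and records [x] in
    [A], or right, which makes the upper triangle at [x.+1] pending. *)
Lemma partial_strip_pending (x : nat) (A B : seq nat) : x < c + k -> x \notin A ->
  nm (partial_strip N c k x.+1 true A B) =
    (0 < k) * nm (partial_strip N c k x.+1 false (rcons A x) B) +
    (x.+1 \notin B) * nm (partial_strip N c k x.+2 true A B).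
Proof.
move=> lt xA.
have hx : x < N by lia.
have hx' : x.+1 < N by lia.
have hy : c + k - x.+1 < N by lia.
pose v : triangle N N := (Ordinal hx, Ordinal hy, false).
pose w : triangle N N := (Ordinal hx, Ordinal hy, true).
pose w' : triangle N N := (Ordinal hx', Ordinal hy, true).
rewrite /nm (@num_matchings_expand2 _ _ (@share_edge_sym N N) (@share_edge_irr N N) _ v w w').
- have -> : (w \in partial_strip N c k x.+1 true A B) && share_edge v w = (0 < k).
    by rewrite inE share_edge_up_low /facing /= (negPf xA); lia.
  have -> : (w' \in partial_strip N c k x.+1 true A B) && share_edge v w' = (x.+1 \notin B).
    by rewrite inE share_edge_up_low /facing /=; case: (x.+1 \in B); lia.
  congr addn; congr muln; congr num_matchings.
    apply/setP=> [[[i j] b]]; rewrite !inE /= !xpair_eqE -!val_eqE /= mem_rcons inE.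
    case: b; rewrite /= ?andbF ?andbT /=; last by lia.
    by case: (nat_of_ord i \in B); case: (nat_of_ord i \in A) / boolP => iA;
      rewrite /= ?andbF ?andbT; lia.
  apply/setP=> [[[i j] b]]; rewrite !inE /= !xpair_eqE -!val_eqE /=.
  case: b; rewrite /= ?andbF ?andbT /=; last by lia.
  by case: (nat_of_ord i \in B); case: (nat_of_ord i \in A); rewrite /= ?andbF ?andbT; lia.
- by rewrite inE /=; lia.
- by rewrite !xpair_eqE -!val_eqE /=; lia.
- move=> [[i j] []]; rewrite inE /=; last by rewrite share_edge_same.
  rewrite share_edge_up_low /facing /= => D E.
  have [ix|ix] : nat_of_ord i = x /\ nat_of_ord j = c + k - x.+1 \/
                 nat_of_ord i = x.+1 /\ nat_of_ord j = c + k - x.+1.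
    by move: D E; case: (_ \in A); case: (_ \in B); rewrite /= ?andbF ?andbT; lia.
  + by left; case: ix => ix jx; congr (_, _, _); apply: val_inj.
  + by right; case: ix => ix jx; congr (_, _, _); apply: val_inj.
Qed.

(** The strip ends on both sides with a lower triangle: from [x] on there is one lower triangle too
    many, and the forced moves run into [partial_strip_stuck]. *)
Lemma partial_strip_nil (x : nat) (A : seq nat) : x <= c + k ->
  nm (partial_strip N c k x false A [::]) = 0.
Proof.
move=> le; have [n] : exists n, c + k = x + n by exists (c + k - x); lia.
elim: n x {le} => [|n IHn] x E.
  by rewrite -(addn0 x) -E partial_strip_stuck.
by rewrite partial_strip_shift ?IHn //; lia.
Qed.

Lemma partial_strip_skip (x b : nat) (A B : seq nat) : x <= b <= c + k ->
  (forall i, i < b -> i \notin B) ->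
  nm (partial_strip N c k x false A (b :: B)) = nm (partial_strip N c k b.+1 true A B).
Proof.
case/andP=> xb le nB; have [n bE] : exists n, b = x + n by exists (b - x); lia.
elim: n x bE {xb} => [|n IHn] x bE.
  by rewrite -[x]addn0 -bE partial_strip_removed ?mem_head // partial_strip_drop.
rewrite partial_strip_shift; [|lia|]; last by rewrite inE negb_or nB; lia.
by rewrite IHn //; lia.
Qed.

(* The pending upper triangle is pushed to the right until some t < b, where   *)
(* it is matched downwards: this is where interlacing comes from.              *)
Lemma partial_strip_sum (x b : nat) (A B : seq nat) : x < b <= c + k ->
  (forall i, i \in A -> i < x) -> (forall i, i <= b -> i \notin B) ->
  nm (partial_strip N c k x.+1 true A (b :: B)) =
    (0 < k) * \sum_(x <= t < b) nm (partial_strip N c k b.+1 true (rcons A t) B).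
Proof.
case/andP=> xb le; have [n bE] : exists n, b = x.+1 + n by exists (b - x.+1); lia.
elim: n x bE {xb} => [|n IHn] x bE hA nB.
  rewrite partial_strip_pending; [|lia|]; last by apply/negP=> /hA; rewrite ltnn.
  have -> : b = x.+1 by lia.
  rewrite inE eqxx addn0 big_nat1 partial_strip_skip //; first lia.
  by move=> i ib; apply: nB; lia.
rewrite partial_strip_pending; [|lia|]; last by apply/negP=> /hA; rewrite ltnn.
rewrite inE negb_or nB ?andbT; last by lia.
rewrite IHn //; [|lia|by move=> i /hA; lia].
rewrite [in RHS]big_ltn; last by lia.
rewrite partial_strip_skip; [|lia|by move=> i ib; apply: nB; lia].
have -> : x.+1 != b by lia.
by rewrite mulnDr mul1n.
Qed.

(** After the last removed lower triangle a downward match is fatal by [partial_strip_nil], so the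
    rest of the strip is forced to the right. *)
Lemma partial_strip_last (x : nat) (A : seq nat) : x <= c + k ->
  (forall i, i \in A -> i < x) ->
  nm (partial_strip N c k x.+1 true A [::]) = nm (strips N c k A).
Proof.
move=> le; have [n] : exists n, c + k = x + n by exists (c + k - x); lia.
elim: n x {le} => [|n IHn] x E hA; first by rewrite partial_strip_end //; lia.
rewrite partial_strip_pending; [|lia|]; last by apply/negP=> /hA; rewrite ltnn.
rewrite partial_strip_nil ?muln0 ?add0n ?mul1n; last by lia.
by apply: IHn => [|i /hA]; lia.
Qed.

End PartialStrip.

(** * Cutting the hexagon along its middle line *)

(* The reflection in the middle line x + y = N.                                *)
Definition reflect_triangle (N : nat) (t : triangle N N) : triangle N N :=
  (rev_ord t.1.2, rev_ord t.1.1, ~~ t.2).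

Lemma reflect_triangleK (N : nat) : involutive (@reflect_triangle N).
Proof. by case=> [[x y] b]; rewrite /reflect_triangle /= !rev_ordK negbK. Qed.

Lemma mem_reflect (N : nat) (D : {set triangle N N}) (t : triangle N N) :
  (t \in @reflect_triangle N @: D) = (reflect_triangle t \in D).
Proof.
by rewrite -{1}[t]reflect_triangleK mem_imset //; apply: inv_inj (@reflect_triangleK N).
Qed.

Lemma share_edge_reflect (N : nat) (s t : triangle N N) :
  share_edge (reflect_triangle s) (reflect_triangle t) = share_edge s t.
Proof.
case: s t => [[x y] b] [[x' y'] b']; rewrite /reflect_triangle /=.
have [x_lt y_lt x'_lt y'_lt] : [/\ x < N, y < N, x' < N & y' < N] by [].
case: b b' => [] [] /=; rewrite ?share_edge_same //.
  by rewrite share_edge_up_low share_edge_low_up /facing /=; lia.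
by rewrite share_edge_up_low share_edge_low_up /facing /=; lia.
Qed.

Lemma imset_setD (aT rT : finType) (f : aT -> rT) (A B : {set aT}) :
  injective f -> f @: (A :\: B) = f @: A :\: f @: B.
Proof.
move=> f_inj; apply/setP=> y; apply/imsetP/setDP=> [[x /setDP[xA xB] ->]|[]].
  by rewrite imset_f // mem_imset.
by case/imsetP=> x xA ->; rewrite mem_imset // => xB; exists x; rewrite // inE xB.
Qed.

Definition mid_lower (N : nat) (i : 'I_N) : triangle N N := (i, rev_ord i, true).
Definition mid_upper (N : nat) (i : 'I_N) : triangle N N := (i, rev_ord i, false).

Lemma reflect_mid_lower (N : nat) (i : 'I_N) :
  reflect_triangle (mid_lower i) = mid_upper i.
Proof. by rewrite /reflect_triangle /= rev_ordK. Qed.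

Lemma hexagon_halves (a c : nat) :
  hexagon a a c = strips (a + c) c a [::] :|:
                  @reflect_triangle (a + c) @: strips (a + c) c a [::].
Proof.
apply/setP=> t; rewrite inE [in RHS]inE mem_reflect !inE.
case: t => [[x y] b]; have [x_lt y_lt] : x < a + c /\ y < a + c by [].
by case: b; rewrite /in_hexagon /= in_nil andbF; lia.
Qed.

Lemma strips_mid (a c : nat) (S : {set 'I_(a + c)}) :
  strips (a + c) c a [::] :\: @mid_lower (a + c) @: S =
  strips (a + c) c a [seq val i | i <- enum S].
Proof.
apply/setP=> [[[x y] b]]; rewrite !inE /=.
have -> : ((x, y, b) \in @mid_lower (a + c) @: S) = [&& b, y == rev_ord x & x \in S].
  apply/imsetP/and3P => [[i iS [-> -> ->]]|[-> /eqP-> xS]]; last by exists x.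
  by rewrite iS.
rewrite (mem_map val_inj) mem_enum -val_eqE /=.
have [x_lt y_lt] : x < a + c /\ y < a + c by [].
case: b; last by lia.
by case: (x \in S); rewrite /= ?in_nil ?andbT ?andbF; lia.
Qed.

Lemma center_lozenge (N : nat) (mid : 'I_N) (L : {set triangle N N}) :
  N = (mid : nat).*2.+1 ->
  is_lozenge_with_center2 (N, N) L = (L == [set mid_lower mid; mid_upper mid]).
Proof.
move=> NE.
have revm : rev_ord mid = mid :> nat by rewrite /=; lia.
(* The three kinds of lozenges differ in the parities of their doubled centre; both coordinates are
   odd, like [N], only if the two triangles share a cell. *)
have cE (x y x' y' : 'I_N) : facing x y x' y' ->
    \sum_(v <- common_vertices (x, y, true) (x', y', false)) v.1 =
       (if x' < x then x.*2 else if y' < y then x.*2.+1 else x.*2.+1) /\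
    \sum_(v <- common_vertices (x, y, true) (x', y', false)) v.2 =
       (if x' < x then y.*2.+1 else if y' < y then y.*2 else y.*2.+1).
  rewrite /facing /common_vertices /= !inE !xpair_eqE /= => h; split; move: h;
    (do ![case: eqP => /= ?; try (exfalso; lia)]); rewrite ?big_cons ?big_nil /=;
    do ?[case: ltnP => /= ?]; lia.
have key (x y x' y' : 'I_N) : facing x y x' y' ->
    (if x' < x then x.*2 else if y' < y then x.*2.+1 else x.*2.+1) = N ->
    (if x' < x then y.*2.+1 else if y' < y then y.*2 else y.*2.+1) = N ->
    (x, y, true) = mid_lower mid /\ (x', y', false) = mid_upper mid.
  rewrite /facing => f e1 e2.
  have [x1 [y1 [x2 y2]]] : x = mid :> nat /\ y = mid :> nat /\ x' = mid :> nat /\ y' = mid :> nat.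
    by move: f e1 e2; case: (ltnP x' x) => ?; case: (ltnP y' y) => ? /=; lia.
  have [-> ->] : x = mid /\ y = rev_ord mid.
    by split; apply: ord_inj; rewrite ?revm ?x1 ?y1 ?x2 ?y2.
  have [-> ->] : x' = mid /\ y' = rev_ord mid.
    by split; apply: ord_inj; rewrite ?revm ?x1 ?y1 ?x2 ?y2.
  by [].
apply/existsP/eqP=> [[s /existsP[t /and4P[/eqP-> st /eqP e1 /eqP e2]]]|->].
  case: s t st e1 e2 => [[x y] []] [[x' y'] []]; rewrite ?share_edge_same //.
    rewrite share_edge_low_up => f; have [-> ->] := cE _ _ _ _ f => e1 e2.
    by have [-> ->] := key _ _ _ _ f e1 e2.
  have cs := common_vertices_sym (x, y, false) (x', y', true).
  rewrite share_edge_up_low !(perm_big _ cs) => f; have [-> ->] := cE _ _ _ _ f => e1 e2.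
  by have [-> ->] := key _ _ _ _ f e1 e2; rewrite setUC.
have f : facing mid (rev_ord mid) mid (rev_ord mid) by rewrite /facing !eqxx.
exists (mid_lower mid); apply/existsP; exists (mid_upper mid).
have [e1 e2] := cE _ _ _ _ f.
by rewrite eqxx share_edge_low_up f e1 e2 !ltnn revm -NE !eqxx.
Qed.

Lemma num_centered_tilingsE (a c : nat) (mid : 'I_(a + c)) :
  0 < a -> a + c = (mid : nat).*2.+1 ->
  num_centered_tilings a a c =
    \sum_(S : {set 'I_(a + c)} | mid \in S)
       num_matchings (@share_edge (a + c) (a + c))
         (strips (a + c) c a [seq val i | i <- enum S]) ^ 2.
Proof.
set N := a + c in mid *; move=> a_gt0 NE.
set D1 := strips N c a [::]; set D2 := @reflect_triangle N @: D1.
pose bridges (T : {set {set triangle N N}}) :=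
  [set i : 'I_N | [set mid_lower i; mid_upper i] \in T].
have cutE (S : {set 'I_N}) : num_matchings (@share_edge N N) (D1 :\: @mid_lower N @: S) *
              num_matchings (@share_edge N N) (D2 :\: @mid_upper N @: S) =
    num_matchings (@share_edge N N) (strips N c a [seq val i | i <- enum S]) ^ 2.
  rewrite -mulnn -(strips_mid S : D1 :\: _ = _); congr (_ * _).
  rewrite -[RHS](num_matchings_imset _ (inv_inj (@reflect_triangleK N)) (@share_edge_reflect N)).
  congr num_matchings; rewrite /D2 imset_setD; last exact: inv_inj (@reflect_triangleK N).
  by congr (_ :\: _); rewrite -imset_comp; apply: eq_imset => i /=; rewrite reflect_mid_lower.
have dD : [disjoint D1 & D2].
  rewrite disjoints_subset; apply/subsetP=> [[[x y] b]]; rewrite in_setC /D2 mem_reflect !inE /=.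
  have [x_lt y_lt] : x < N /\ y < N by [].
  by case: b; rewrite /= in_nil andbF; lia.
have uD (i : 'I_N) : mid_lower i \in D1.
  by rewrite inE /= in_nil andbF; have := ltn_ord i; rewrite /N; lia.
have vD (i : 'I_N) : mid_upper i \in D2 by rewrite -reflect_mid_lower imset_f.
have uv (i : 'I_N) : share_edge (mid_lower i) (mid_upper i).
  by rewrite share_edge_low_up /facing !eqxx.
have cross s t : s \in D1 -> t \in D2 -> share_edge s t ->
    exists2 i : 'I_N, s = mid_lower i & t = mid_upper i.
  case: s t => [[x y] b] [[x' y'] b']; rewrite /D2 mem_reflect !inE /= !in_nil !andbF.
  have [x_lt y_lt x'_lt y'_lt] : [/\ x < N, y < N, x' < N & y' < N] by [].
  rewrite /N in x_lt y_lt x'_lt y'_lt.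
  case: b b' => [] [] /=; rewrite ?share_edge_same // => s1 s2.
    rewrite share_edge_low_up /facing => f; exists x; congr (_, _, _); apply: val_inj => /=; lia.
  rewrite share_edge_up_low /facing; lia.
have l_inj : injective (@mid_lower N) by move=> i j [].
have u_inj : injective (@mid_upper N) by move=> i j [].
have cut := num_matchings_cut (@share_edge_sym N N) l_inj u_inj uD vD dD uv cross.
have centeredE T : is_centered T = (mid \in bridges T).
  rewrite inE; apply/exists_inP/idP => [[L LT]|mT].
    by rewrite /hexagon_center2 (center_lozenge _ NE) => /eqP <-.
  by exists [set mid_lower mid; mid_upper mid]; rewrite // /hexagon_center2 (center_lozenge _ NE).
rewrite /num_centered_tilings -sum1_card.
rewrite (partition_big bridges (fun S : {set 'I_N} => mid \in S)) /=; last first.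
  by move=> T; rewrite inE centeredE => /andP[].
apply: eq_bigr => S mS; rewrite -cutE -cut sum1_card; apply: eq_card => T.
rewrite !inE unfold_in /= inE centeredE -/(bridges T) /is_lozenge_tiling hexagon_halves.
case: eqP => [->|_]; last by rewrite !andbF.
by rewrite mS !andbT.
Qed.

Local Open Scope ring_scope.

(** * The determinant of a half hexagon *)

Section RowDeterminant.
Variable R : comPzRingType.
Implicit Type rows : seq (nat -> R).

Definition rows_det (n : nat) rows : R :=
  \det (\matrix_(i < n, j < n) nth (fun=> 0) rows i j).

(** Linearity of the determinant in one row; it turns the sums over interlacing positions into
    differences of binomial rows. *)
Lemma rows_det_sum (n : nat) (I : Type) (r : seq I) (f : I -> nat -> R) rows1 rows2 :
  (size rows1 < n)%N ->
  rows_det n (rows1 ++ (fun j => \sum_(t <- r) f t j) :: rows2) =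
  \sum_(t <- r) rows_det n (rows1 ++ f t :: rows2).
Proof.
move=> lt; pose i0 := Ordinal lt.
under eq_bigr => t _ do rewrite /rows_det (expand_det_row _ i0).
rewrite /rows_det (expand_det_row _ i0) exchange_big /=; apply: eq_bigr => j _.
rewrite mxE nth_cat ltnn subnn /= mulr_suml; apply: eq_bigr => t _.
rewrite mxE nth_cat ltnn subnn /=; congr (_ * _).
rewrite /cofactor; congr (_ * \det _); apply/matrixP=> i k; rewrite !mxE !nth_cat.
case: ltnP => // le; have : (lift i0 i != size rows1 :> nat)%N by rewrite eq_sym neq_lift.
by case E: (lift i0 i - size rows1)%N => [|m] //; lia.
Qed.

End RowDeterminant.

Definition binom_row (b : nat) : nat -> rat := fun j => 'C(b, j)%:R.

Definition step_row (b b' : nat) : nat -> rat := fun j => 'C(b', j.+1)%:R - 'C(b, j.+1)%:R.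

Fixpoint step_rows (b : nat) (bs : seq nat) : seq (nat -> rat) :=
  if bs is b' :: bs' then step_row b b' :: step_rows b' bs' else [::].

Lemma nth_step_rows (b : nat) (bs : seq nat) (i : nat) : (i < size bs)%N ->
  nth (fun=> 0) (step_rows b bs) i =
    step_row (nth 0%N (b :: bs) i) (nth 0%N (b :: bs) i.+1).
Proof. by elim: bs b i => //= b' bs IH b [|i] //= lt; rewrite IH. Qed.

Lemma step_rowE (b b' j : nat) : (b <= b')%N ->
  step_row b b' j = \sum_(b <= t < b') binom_row t j.
Proof.
move=> le; rewrite /step_row -(telescope_sumr (fun t => 'C(t, j.+1)%:R)) //; apply: eq_bigr => t _.
by rewrite binS natrD /binom_row addrAC subrr add0r.
Qed.

Definition binom_det (bs : seq nat) : rat :=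
  rows_det (size bs) [seq binom_row b | b <- bs].

(** Subtracting from each row the one above it turns the first column, all ['C(_, 0) = 1], into (1,
    0, ..., 0). The shift to [j.+1] in [step_row] comes from deleting this column. *)
Lemma binom_det_cons (b : nat) (bs : seq nat) :
  binom_det (b :: bs) = rows_det (size bs) (step_rows b bs).
Proof.
rewrite /binom_det /rows_det /=; set k := size bs.
pose X : 'M[rat]_k.+1 := \matrix_(i, j) nth (fun=> 0) (map binom_row (b :: bs)) i j.
pose U : 'M[rat]_k.+1 := \matrix_(i, j) ((i == j)%:R - (i == j.+1 :> nat)%:R).
have dU : \det U = 1.
  rewrite det_trig; last first.
    apply/is_trig_mxP => i j ij; rewrite mxE.
    by rewrite [_ == j.+1 :> nat]ltn_eqF ?ltnS 1?ltnW // -val_eqE /= ltn_eqF // subr0.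
  by apply: big1 => i _; rewrite mxE eqxx ltn_eqF // subr0.
have XE i j : X i j = 'C(nth 0%N (b :: bs) i, j)%:R.
  by rewrite mxE (nth_map 0%N) //= ltn_ord.
have UX0 j : (U *m X) 0 j = X 0 j.
  rewrite mxE (bigD1 0) //= mxE eqxx subr0 mul1r big1 ?addr0 // => i i0.
  by rewrite mxE eq_sym (negPf i0) subr0 mul0r.
have UXS (i : 'I_k) j : (U *m X) (lift 0 i) j = X (lift 0 i) j - X (widen_ord (leqnSn k) i) j.
  rewrite mxE (bigD1 (lift 0 i)) //= mxE eqxx /= [_ == _.+1 :> nat]ltn_eqF // subr0 mul1r.
  congr (_ + _); rewrite (bigD1 (widen_ord (leqnSn k) i)) /=; last first.
    by rewrite -val_eqE /= /bump /= add1n ltn_eqF.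
  rewrite mxE /= /bump /= add1n eqxx -val_eqE /= /bump /= add1n gtn_eqF // sub0r mulN1r.
  rewrite big1 ?addr0 // => l /andP[l1 l2]; rewrite mxE.
  move: l1 l2; rewrite -!val_eqE /= /bump /= add1n eqSS => l1 l2.
  by rewrite eq_sym (negPf l1) eq_sym (negPf l2) subr0 mul0r.
rewrite -[LHS]mul1r -dU -det_mulmx (expand_det_col _ 0) (bigD1 0) //= UX0 XE bin0 mul1r.
rewrite big1 ?addr0; last first.
  by move=> i; case: (unliftP 0 i) => [j ->|->] // _; rewrite UXS !XE !bin0 subrr mul0r.
rewrite /cofactor addn0 expr0 mul1r; congr (\det _); apply/matrixP=> i j.
by rewrite [LHS]mxE [LHS]mxE UXS !XE mxE nth_step_rows //= /step_row.
Qed.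

(** Induction on the number of strips: the last strip transforms [bs] into all sequences interlacing
    it, one element shorter. With no strip the region is empty whatever [bs] is and has one
    matching, hence the condition on [nilp bs]. *)
Lemma num_matchings_strips (N c k : nat) (bs : seq nat) : (c + k <= N)%N ->
  sorted ltn bs -> all (ltn^~ (c + k)%N) bs -> (0 < k)%N || nilp bs ->
  (num_matchings (@share_edge N N) (strips N c k bs))%:R =
    if size bs == k then binom_det bs else 0.
Proof.
elim: k bs => [|k IHk] bs lekN sbs abs.
  move=> /nilP ->; have -> : strips N c 0 [::] = set0.
    by apply/setP=> [[[i j] b]]; rewrite !inE /=; case: b; lia.
  by rewrite num_matchings0 /binom_det /rows_det det_mx00.
move=> _; have {lekN} ckN : (c + k < N)%N by lia.
(* The strip has been read up to [b]: [ts] lists the interlacing positions already chosen, as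
   binomial rows, while those between consecutive elements of [b :: rs] remain summed, as step
   rows. *)
have main (rs : seq nat) b ts : sorted ltn ts -> all (ltn^~ b) ts -> path ltn b rs ->
    all (ltn^~ (c + k).+1) (b :: rs) -> (0 < k)%N || nilp ts ->
  (num_matchings (@share_edge N N) (partial_strip N c k b.+1 true ts rs))%:R =
    if (size ts + size rs == k)%N
    then rows_det k ([seq binom_row t | t <- ts] ++ step_rows b rs) else 0.
  elim: rs b ts => [|b' rs IH] b ts sts ats /= pb arb kts.
    rewrite partial_strip_last //; last by move=> i /(allP ats).
      rewrite IHk ?addn0 ?cats0 //; [|exact: ltnW|].
        by case: eqP => // <-.
      by apply: sub_all ats => i /=; lia.
    by move: arb => /andP[]; lia.
  move: pb arb => /andP[bb' pb'] /and3P[lb lb' ars].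
  have rs_gt i : i \in rs -> (b' < i)%N.
    by move=> irs; apply: (allP (order_path_min ltn_trans pb')).
  rewrite partial_strip_sum //; [|lia| by move=> i /(allP ats)|]; last first.
    by move=> i ib'; apply/negP=> /rs_gt; lia.
  case: (posnP k) => [k0|k_gt0].
    by rewrite mul0n; case: eqP => //; lia.
  rewrite mul1n natr_sum.
  have -> : \sum_(b <= t < b') (num_matchings (@share_edge N N)
                (partial_strip N c k b'.+1 true (rcons ts t) rs))%:R =
      \sum_(b <= t < b') (if (size ts + (size rs).+1 == k)%N then
         rows_det k ([seq binom_row t | t <- ts] ++ binom_row t :: step_rows b' rs) else 0).
    apply: eq_big_nat => t /andP[bt tb']; rewrite IH //= ?k_gt0 //.
    - by rewrite size_rcons addSnnS map_rcons cat_rcons.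
    - rewrite (sorted_pairwise ltn_trans) pairwise_rcons -(sorted_pairwise ltn_trans) sts andbT.
      by apply: sub_all ats => i /=; lia.
    - rewrite all_rcons tb' /=; by apply: sub_all ats => i /=; lia.
    - by rewrite lb'.
  case: eqP => [kE|_]; last by rewrite big1.
  rewrite -rows_det_sum ?size_map; last by lia.
  congr (\det _); apply/matrixP=> i j; rewrite !mxE !nth_cat size_map.
  case: ltnP => // _; case: (i - size ts)%N => //=.
  by rewrite step_rowE // ltnW.
case: bs sbs abs => [|b bs] /= pb abs.
  by rewrite -(partial_strip_start ckN false) partial_strip_nil.
rewrite -(partial_strip_start ckN false) partial_strip_skip //.
- rewrite main //=; last by rewrite orbT.
    by rewrite add0n eqSS; case: eqP => // <-; rewrite binom_det_cons.
  by move: abs; rewrite addnS.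
- by move: abs; lia.
- move=> i ib; apply/negP => /(allP (order_path_min ltn_trans pb)) /=; lia.
Qed.

(** * Sums of squared determinants *)

Section Andreief.
Variables (F : fieldType) (T : finType) (a : nat) (phi : nat -> T -> F).
Implicit Type f : 'I_a -> T.

Definition sample_det f : F := \det (\matrix_(i < a, j < a) phi j (f i)).

Lemma sample_det_noninj f : ~~ injectiveb f -> sample_det f = 0.
Proof.
case/injectivePn=> i [j ij fij]; apply: (determinant_alternate ij) => k.
by rewrite !mxE fij.
Qed.

(** The two samples differ by a permutation of the rows, whose sign disappears in the square. *)
Lemma sample_det_image f f' : injective f -> injective f' ->
  [set f i | i in 'I_a] = [set f' i | i in 'I_a] -> sample_det f ^+ 2 = sample_det f' ^+ 2.
Proof.
move=> f_inj f'_inj im_eq.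
have memf i : f i \in codom f'.
  have: f i \in [set f' i | i in 'I_a] by rewrite -im_eq imset_f.
  by case/imsetP=> j _ ->; apply: codom_f.
have s_inj : injective (fun i => iinv (memf i)).
  by move=> i j /(congr1 f'); rewrite !f_iinv => /f_inj.
rewrite /sample_det.
have -> : \matrix_(i < a, j < a) phi j (f i) =
          row_perm (perm s_inj) (\matrix_(i < a, j < a) phi j (f' i)).
  by apply/matrixP=> i j; rewrite !mxE permE f_iinv.
by rewrite row_permE det_mulmx det_perm exprMn sqrr_sign mul1r.
Qed.

Lemma sum_sample_det_sets (c0 : T) :
  \sum_(f : {ffun 'I_a -> T} | c0 \in [set f i | i in 'I_a]) sample_det f ^+ 2 =
  a`!%:R * \sum_(S : {set T} | (c0 \in S) && (#|S| == a))
    sample_det (fun i => nth c0 (enum S) i) ^+ 2.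
Proof.
pose im (f : {ffun 'I_a -> T}) := [set f i | i in 'I_a].
rewrite (bigID (fun f : {ffun 'I_a -> T} => injectiveb f)) /= addrC big1 ?add0r; last first.
  by move=> f /andP[_ /sample_det_noninj->]; rewrite expr0n.
rewrite (partition_big im (fun S : {set T} => (c0 \in S) && (#|S| == a))) /=; last first.
  move=> f /andP[-> /injectiveP f_inj] /=.
  by rewrite card_imset // card_ord.
rewrite mulr_sumr; apply: eq_bigr => S /andP[c0S /eqP cS].
have e_inj : injective (fun i : 'I_a => nth c0 (enum S) i).
  move=> i j /eqP; rewrite nth_uniq ?enum_uniq -?cardE ?cS //.
  by move/eqP/val_inj.
have e_im : [set nth c0 (enum S) (i : 'I_a) | i in 'I_a] = S.
  apply/eqP; rewrite eqEcard card_imset // card_ord cS leqnn andbT.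
  apply/subsetP=> _ /imsetP[i _ ->].
  by rewrite -mem_enum mem_nth // -cardE cS.
rewrite (eq_bigr (fun=> sample_det (fun i => nth c0 (enum S) i) ^+ 2)); last first.
  move=> f /andP[/andP[_ /injectiveP f_inj] /eqP fS]; apply: sample_det_image => //.
  by rewrite e_im -fS.
rewrite sumr_const -[LHS]mulr_natl; congr (_%:R * _).
have <- : (#|S| ^_ #|'I_a| = a`!)%N by rewrite card_ord cS ffactnn.
rewrite -card_inj_ffuns_on; apply: eq_card => f; rewrite !inE.
rewrite unfold_in /=; case: injectiveP => f_inj; rewrite ?andbF ?andbT //.
apply/andP/forallP => [[_ /eqP <-] i|fS]; first exact: imset_f.
have /eqP imS : im f == S.
  rewrite eqEcard card_imset // card_ord cS leqnn andbT.
  by apply/subsetP=> _ /imsetP[i _ ->]; apply: fS.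
by rewrite -/(im f) imS c0S.
Qed.

Variable h : nat -> F.
Hypothesis h_neq0 : forall k : 'I_a, h k != 0.
Hypothesis orth : forall j k : 'I_a,
  \sum_x phi j x * phi k x = if j == k then h k else 0.

(** Expand both determinants over permutations [s] and [t]. The sums over the values of [f] off [i0]
    factor, and orthogonality leaves only [s = t]; the factor at [i0] is not summed and replaces
    [h (s i0)] by [phi (s i0) c0 ^+ 2]. *)
Lemma sum_sample_det_fixed (c0 : T) (i0 : 'I_a) :
  \sum_(f : {ffun 'I_a -> T} | f i0 == c0) sample_det f ^+ 2 =
  \sum_(s : 'S_a) (\prod_(k < a) h k) * (phi (s i0) c0 ^+ 2 / h (s i0)).
Proof.
pose Q (i : 'I_a) x := (i == i0) ==> (x == c0).
have famQ (f : {ffun 'I_a -> T}) : (f i0 == c0) = (f \in family Q).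
  apply/eqP/familyP => [fi i|/(_ i0)]; rewrite unfold_in /Q; last by rewrite eqxx => /eqP.
  by apply/implyP=> /eqP ->; rewrite fi.
transitivity (\sum_(s : 'S_a) \sum_(t : 'S_a) (-1) ^+ s * (-1) ^+ t *
    \prod_(i < a) \sum_(x | Q i x) phi (s i) x * phi (t i) x).
  rewrite (eq_bigl _ _ famQ).
  under [RHS]eq_bigr => s _ do under eq_bigr => t _ do rewrite bigA_distr_big_dep mulr_sumr.
  under [RHS]eq_bigr => s _ do rewrite exchange_big.
  rewrite exchange_big; apply: eq_bigr => f _ /=.
  rewrite expr2 {1}/sample_det /determinant mulr_suml; apply: eq_bigr => s _.
  rewrite /sample_det /determinant mulr_sumr; apply: eq_bigr => t _.
  rewrite big_split /= mulrACA.
  by congr (_ * (_ * _)); apply: eq_bigr => i _; rewrite mxE.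
apply: eq_bigr => s _; rewrite (bigD1 s) //= [X in _ + X]big1 ?addr0; last first.
  move=> t ts.
  (* Two permutations that agree off one point agree everywhere. *)
  have [i i_i0 si_ti] : exists2 i, i != i0 & s i != t i.
    apply/exists_inP; apply: contraNT ts => /exists_inPn same.
    have {}same i : i != i0 -> s i = t i by move/same; rewrite negbK => /eqP.
    apply/eqP/permP=> i; case: (eqVneq i i0) => [->|/same //].
    apply: contraTeq isT => ne; set j := (s^-1 (t i0))%g.
    have sj : s j = t i0 by rewrite permKV.
    have ji0 : j != i0 by apply: contraNneq ne => ji; rewrite -sj ji.
    by have := same j ji0; rewrite sj => /perm_inj ij; rewrite ij eqxx in ji0.
  rewrite (bigD1 i) //= (eq_bigl xpredT) => [|x]; last by rewrite /Q (negPf i_i0).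
  by rewrite orth (negPf si_ti) mul0r mulr0.
rewrite -signr_addb addbb expr0 mul1r.
rewrite [X in _ = X * _](reindex_inj (@perm_inj _ s)) /=.
rewrite (bigD1 i0) //= [in RHS](bigD1 i0) //=.
rewrite (eq_bigl (pred1 c0)) => [|x]; last by rewrite /Q eqxx.
rewrite big_pred1_eq -expr2.
rewrite (eq_bigr (fun i => h (s i))) => [|i i_i0].
  by field; apply: h_neq0.
rewrite (eq_bigl xpredT) => [|x]; last by rewrite /Q (negPf i_i0).
by rewrite orth eqxx.
Qed.

(** Andreief's identity with a marked point. A sample with nonzero determinant is injective, so it
    takes the value [c0] at exactly one index, and the sum splits over that index [i0]. For each
    permutation [s], [s i0] runs over all degrees, so the [a!] permutations contribute equally and
    cancel the [a!] orderings of a set. *)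
Lemma sum_sample_det_marked (c0 : T) :
  a`!%:R != 0 :> F ->
  \sum_(S : {set T} | (c0 \in S) && (#|S| == a))
    sample_det (fun i => nth c0 (enum S) i) ^+ 2 =
  (\prod_(k < a) h k) * \sum_(k < a) phi k c0 ^+ 2 / h k.
Proof.
move=> a_neq0; apply: (mulfI a_neq0); rewrite -sum_sample_det_sets.
transitivity (\sum_(i0 : 'I_a) \sum_(f : {ffun 'I_a -> T} | f i0 == c0) sample_det f ^+ 2).
  rewrite (exchange_big_dep xpredT) //= [in LHS]big_mkcond /=; apply: eq_bigr => f _.
  case: (boolP (injectiveb f)) => [/injectiveP f_inj|/sample_det_noninj ->]; last first.
    by rewrite expr0n /= if_same big1.
  case: imsetP => [[i _ ->]|nim].
    by rewrite (eq_bigl (pred1 i)) ?big_pred1_eq // => j; rewrite /= (inj_eq f_inj).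
  by rewrite big1 // => i /eqP fi; case: nim; exists i.
under eq_bigr => i0 _ do rewrite sum_sample_det_fixed.
rewrite exchange_big /=.
rewrite (eq_bigr (fun=> (\prod_(k < a) h k) * \sum_(k < a) phi k c0 ^+ 2 / h k)).
  by rewrite sumr_const card_Sn mulr_natl.
move=> s _; rewrite -mulr_sumr; congr (_ * _).
by rewrite [RHS](reindex_inj (@perm_inj _ s)).
Qed.

End Andreief.

(** * Discrete Chebyshev polynomials *)

Lemma fact_rat_neq0 (n : nat) : n`!%:R != 0 :> rat.
Proof. by rewrite pnatr_eq0 -lt0n fact_gt0. Qed.

(** The change of basis from powers to the [q j] is unitriangular. *)
Lemma det_monic_basis (R : comNzRingType) (n : nat) (q : nat -> {poly R}) (x : 'I_n -> R) :
  (forall j, q j \is monic) -> (forall j, size (q j) = j.+1) ->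
  \det (\matrix_(i < n, j < n) (q j).[x i]) = \det (\matrix_(i < n, j < n) x i ^+ j).
Proof.
move=> mq sq; pose C : 'M[R]_n := \matrix_(k, j) (q j)`_k.
have -> : \matrix_(i < n, j < n) (q j).[x i] = (\matrix_(i < n, j < n) x i ^+ j) *m C.
  apply/matrixP=> i j; rewrite !mxE (@horner_coef_wide _ n) ?sq //.
  by apply: eq_bigr => k _; rewrite !mxE mulrC.
rewrite det_mulmx; suff -> : \det C = 1 by rewrite mulr1.
rewrite -det_tr det_trig.
  apply: big1 => i _; rewrite !mxE.
  by have /monicP := mq i; rewrite lead_coefE sq.
by apply/is_trig_mxP=> i j ij; rewrite !mxE nth_default ?sq.
Qed.

Definition falling (R : nzRingType) (j : nat) : {poly R} := \prod_(l < j) ('X - l%:R%:P).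

Lemma falling_monic (R : nzRingType) (j : nat) : falling R j \is monic.
Proof. by apply: monic_prod => i _; apply: monicXsubC. Qed.

Lemma size_falling (R : nzRingType) (j : nat) : size (falling R j) = j.+1.
Proof. by rewrite /falling size_prod_XsubC /index_enum -enumT size_enum_ord. Qed.

Lemma horner_falling (R : comNzRingType) (j b : nat) : (falling R j).[b%:R] = (b ^_ j)%:R.
Proof.
elim: j => [|j IH]; first by rewrite /falling big_ord0 hornerC.
rewrite /falling big_ord_recr /= -/(falling R j) hornerM IH ffactnSr natrM hornerXsubC.
case: (leqP j b) => [le|lt]; first by rewrite natrB.
by rewrite ffact_small // !mul0r.
Qed.

Lemma det_binomial (n : nat) (b : 'I_n -> nat) :
  (\prod_(j < n) j`!%:R) * \det (\matrix_(i < n, j < n) 'C(b i, j)%:R : 'M[rat]_n) =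
  \det (\matrix_(i < n, j < n) (b i)%:R ^+ j).
Proof.
rewrite -(@det_monic_basis _ _ (falling rat) _ (@falling_monic _) (@size_falling _)).
have -> : \matrix_(i < n, j < n) (falling rat j).[(b i)%:R] =
    (\matrix_(i < n, j < n) 'C(b i, j)%:R) *m diag_mx (\row_(j < n) j`!%:R).
  apply/matrixP=> i j; rewrite mul_mx_diag !mxE horner_falling.
  by rewrite -natrM bin_ffact.
rewrite det_mulmx det_diag mulrC; congr (_ * _).
by apply: eq_bigr => j _; rewrite mxE.
Qed.

(** * Finite differences and summation by parts *)

Section Difference.
Implicit Types p q G : {poly rat}.

Definition diff p := p \Po ('X + 1) - p.

Lemma horner_diff p x : (diff p).[x] = p.[x + 1] - p.[x].
Proof. by rewrite !hornerE horner_comp !hornerE. Qed.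

Lemma coef_diff (m : nat) p (k : nat) : (size p <= m)%N ->
  (diff p)`_k = \sum_(i < m) p`_i * 'C(i, k)%:R - p`_k.
Proof.
move=> le; rewrite coefB; congr (_ - _).
rewrite comp_polyE -(big_mkord xpredT (fun i => p`_i *: ('X + 1) ^+ i)).
rewrite coef_sum -(big_mkord xpredT (fun i => p`_i * 'C(i, k)%:R)).
rewrite [in RHS](big_cat_nat _ (n := size p)) //=.
rewrite [X in _ = _ + X]big_nat_cond [X in _ = _ + X]big1 ?addr0; last first.
  by move=> i /andP[/andP[si _] _]; rewrite nth_default ?mul0r.
apply: eq_bigr => i _; rewrite coefZ; congr (_ * _).
rewrite exprDn coef_sum.
under eq_bigr => j _ do rewrite expr1n mulr1 coefMn coefXn.
case: (leqP k i) => [ki|ik].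
  have lt : (i - k < i.+1)%N by lia.
  rewrite (bigD1 (Ordinal lt)) //= subKn // eqxx bin_sub // big1 ?addr0 // => j ne.
  have /negPf-> : k != (i - j)%N.
    by apply: contraNneq ne => E; rewrite -val_eqE /= E subKn // -ltnS.
  by rewrite mul0rn.
rewrite bin_small // big1 // => j _.
have /negPf-> : k != (i - j)%N by lia.
by rewrite mul0rn.
Qed.

Lemma size_diff (n : nat) p : (size p <= n.+1)%N -> (size (diff p) <= n)%N.
Proof.
move=> sp; apply/leq_sizeP => k nk; rewrite (coef_diff _ sp).
rewrite big_ord_recr /= big1 ?add0r; last first.
  by move=> i _; rewrite bin_small ?mulr0 // (leq_trans _ nk).
case: (eqVneq n k) => [->|ne]; first by rewrite binn mulr1 subrr.
have lt : (n < k)%N by rewrite ltn_neqAle ne.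
by rewrite bin_small // mulr0 sub0r nth_default ?oppr0 // (leq_trans sp).
Qed.

Lemma lead_diff (n : nat) p : (size p <= n.+2)%N -> (diff p)`_n = n.+1%:R * p`_n.+1.
Proof.
move=> sp; rewrite (coef_diff _ sp) !big_ord_recr /= big1 ?add0r; last first.
  by move=> i _; rewrite bin_small ?mulr0.
by rewrite binn binSn; ring.
Qed.

Lemma iter_diffP (k n : nat) p : (size p <= (n + k).+1)%N ->
  (size (iter k diff p) <= n.+1)%N /\ (iter k diff p)`_n = ((n + k) ^_ k)%:R * p`_(n + k).
Proof.
elim: k n => [|k IH] n; first by rewrite addn0 mul1r.
rewrite addnS -addSn => /IH[s c]; split; first exact: size_diff.
rewrite iterS lead_diff // c mulrA -natrM; congr (_%:R * _).
by rewrite [in RHS]ffactnSr mulnC; congr muln; lia.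
Qed.

Lemma iter_diff0 (k : nat) p : (size p <= k)%N -> iter k diff p = 0.
Proof.
case: k => [|k] sp; first by apply/eqP; rewrite -size_poly_leq0.
have [s c] := @iter_diffP k 0 p sp.
by rewrite iterS; apply/eqP; rewrite -size_poly_leq0 size_diff.
Qed.

Lemma horner_iter_diff_shift (k : nat) p x :
  (iter k diff (p \Po ('X + 1))).[x] = (iter k diff p).[x + 1].
Proof.
elim: k x => [|k IH] x; first by rewrite horner_comp !hornerE.
by rewrite !iterS !horner_diff !IH.
Qed.

Lemma horner_iter_diff0 (k : nat) p x :
  (forall i, (i <= k)%N -> p.[x + i%:R] = 0) -> (iter k diff p).[x] = 0.
Proof.
elim: k x => [|k IH] x p0; first by rewrite -[x]addr0 (p0 0%N).
rewrite iterS horner_diff IH; last first.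
  move=> i ik; have -> : x + 1 + i%:R = x + i.+1%:R by ring.
  exact: p0.
by rewrite IH ?subrr // => i ik; apply: p0; apply: leqW.
Qed.

(** The zeros of [G] at both ends are just enough to kill the boundary terms at each of the [k]
    steps. *)
Lemma sum_by_parts (N k : nat) q G :
  (forall i, (i < k)%N -> G.[i%:R] = 0) -> (forall i, (i < k)%N -> G.[(N + i)%:R] = 0) ->
  \sum_(x < N) q.[x%:R] * (iter k diff G).[x%:R] =
  (-1) ^+ k * \sum_(x < N) (iter k diff q).[x%:R] * G.[(x + k)%:R].
Proof.
elim: k q G => [|k IH] q G z1 z2.
  by rewrite mul1r; apply: eq_bigr => x _; rewrite addn0.
pose H := iter k diff G.
have H0 : H.[0] = 0 by apply: horner_iter_diff0 => i ik; rewrite add0r z1.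
have HN : H.[N%:R] = 0 by apply: horner_iter_diff0 => i ik; rewrite -natrD z2.
have tele : \sum_(x < N) (q.[x.+1%:R] * H.[x.+1%:R] - q.[x%:R] * H.[x%:R]) = 0.
  rewrite -(big_mkord xpredT (fun x => q.[x.+1%:R] * H.[x.+1%:R] - q.[x%:R] * H.[x%:R])).
  by rewrite (telescope_sumr (fun x => q.[x%:R] * H.[x%:R])) // H0 HN !mulr0 subrr.
transitivity (- \sum_(x < N) (diff q).[x%:R] * H.[x.+1%:R]).
  apply/eqP; rewrite -subr_eq0 opprK -big_split /= -[X in _ == X]tele.
  apply/eqP; apply: eq_bigr => x _.
  by rewrite !horner_diff -/H -natr1; ring.
pose G1 := G \Po ('X + 1).
have G1E x : G1.[x%:R] = G.[x.+1%:R] by rewrite horner_comp !hornerE natr1.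
have := IH (diff q) G1; rewrite -iterSr => IH1.
under eq_bigr => x _ do rewrite -natr1 -horner_iter_diff_shift.
rewrite IH1; [|by move=> i ik; rewrite G1E z1|by move=> i ik; rewrite G1E -addnS z2].
rewrite exprS mulN1r mulNr; congr (- (_ * _)); apply: eq_bigr => x _.
by rewrite G1E addnS.
Qed.

Lemma horner_iter_diff_sym (k : nat) p c (eps : rat) :
  (forall x, p.[c - x] = eps * p.[x]) ->
  forall x, (iter k diff p).[c - k%:R - x] = (-1) ^+ k * eps * (iter k diff p).[x].
Proof.
move=> sym; elim: k => [|k IH] x; first by rewrite subr0 mul1r sym.
rewrite iterS !horner_diff.
have -> : c - k.+1%:R - x + 1 = c - k%:R - x by rewrite -natr1; ring.
have -> : c - k.+1%:R - x = c - k%:R - (x + 1) by rewrite -natr1; ring.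
by rewrite !IH exprS; ring.
Qed.

End Difference.

(** Classify the subsets of {0, ..., n} of size j + k + 1 by the element [x] that has j elements
    below it and k above. *)
Lemma sum_bin_bin (j k n : nat) :
  (\sum_(x < n.+1) 'C(x, j) * 'C(n - x, k) = 'C(n.+1, (j + k).+1))%N.
Proof.
elim: n k => [|n IH] k.
  by rewrite big_ord1 /= subnn; case: j k => [|j] [|k] //; rewrite ?bin0n ?muln0 // addnS ?bin_small.
rewrite big_ord_recr /= subnn.
case: k => [|k].
  have IH0 := IH 0%N; rewrite addn0 in IH0.
  rewrite bin0 muln1 addn0 [in RHS]binS -IH0; congr (_ + _)%N.
  by apply: eq_bigr => x _; rewrite !bin0.
have IH1 := IH k.+1; rewrite addnS in IH1.
rewrite muln0 addn0 addnS [in RHS]binS -IH1 -(IH k) -big_split /=.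
apply: eq_bigr => x _; rewrite subSn; last by rewrite -ltnS.
by rewrite binS mulnDr.
Qed.

(** * Rodrigues' formula, orthogonality and recurrence *)

Section Chebyshev.
Variable N : nat.
Implicit Types (k : nat) (q : {poly rat}).

(** The monic polynomial with exactly the zeros that [sum_by_parts] asks for. *)
Definition cheb_weight k : {poly rat} :=
  \prod_(i < k) ('X - i%:R%:P) * \prod_(i < k) ('X - (N + i)%:R%:P).

(* Rodrigues' formula, normalized so that cheb k is monic.                     *)
Definition cheb k : {poly rat} :=
  (k`!%:R / (2 * k)`!%:R) *: iter k diff (cheb_weight k).

Definition cheb_norm k : rat :=
  (k`! ^ 4 * 'C(N + k, k.*2.+1))%N%:R / (2 * k)`!%:R.

Let size_weight k : size (cheb_weight k) = (k + k).+1.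
Proof.
rewrite size_proper_mul; last first.
  rewrite !(monicP _) ?mulr1 ?oner_neq0 //; apply: monic_prod => i _; apply: monicXsubC.
by rewrite !size_prod_XsubC /index_enum -!enumT !size_enum_ord addSn addnS.
Qed.

Let weight_lead k : (cheb_weight k)`_(k + k) = 1.
Proof.
have /monicP : cheb_weight k \is monic.
  by apply: rpredM; apply: monic_prod => i _; apply: monicXsubC.
by rewrite lead_coefE size_weight.
Qed.

Lemma cheb_monic k : size (cheb k) = k.+1 /\ cheb k \is monic.
Proof.
have [s c] := @iter_diffP k k (cheb_weight k) (eq_leq (size_weight k)).
have c1 : (cheb k)`_k = 1.
  rewrite coefZ c weight_lead mulr1 addnn -mul2n.
  rewrite -(@ffact_fact (2 * k) k); last by lia.
  rewrite natrM; have -> : (2 * k - k = k)%N by lia.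
  have ff : ((2 * k) ^_ k)%:R != 0 :> rat by rewrite pnatr_eq0 -lt0n ffact_gt0; lia.
  by field; rewrite ff fact_rat_neq0.
have sz : size (cheb k) = k.+1.
  apply/eqP; rewrite eqn_leq (leq_trans (size_scale_leq _ _) s) /=.
  rewrite ltnNge; apply/negP=> le; move/eqP: c1.
  by rewrite nth_default // eq_sym oner_eq0.
by split=> //; apply/monicP; rewrite lead_coefE sz.
Qed.

Lemma cheb_lead k : (cheb k)`_k = 1.
Proof. by have [s /monicP] := cheb_monic k; rewrite lead_coefE s. Qed.

Let weight0 k i : (i < k)%N -> (cheb_weight k).[i%:R] = 0.
Proof.
by move=> ik; rewrite hornerM !horner_prod (bigD1 (Ordinal ik)) //= hornerXsubC subrr !mul0r.
Qed.

Let weightN k i : (i < k)%N -> (cheb_weight k).[(N + i)%:R] = 0.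
Proof.
move=> ik; rewrite hornerM !horner_prod [X in _ * X](bigD1 (Ordinal ik)) //=.
by rewrite hornerXsubC subrr mul0r mulr0.
Qed.

Lemma sum_cheb k q :
  \sum_(x < N) q.[x%:R] * (cheb k).[x%:R] =
  (k`!%:R / (2 * k)`!%:R) * ((-1) ^+ k *
     \sum_(x < N) (iter k diff q).[x%:R] * (cheb_weight k).[(x + k)%:R]).
Proof.
rewrite -(sum_by_parts q (@weight0 k) (@weightN k)) mulr_sumr; apply: eq_bigr => x _.
by rewrite hornerZ mulrCA.
Qed.

Lemma cheb_orth_low k q : (size q <= k)%N ->
  \sum_(x < N) q.[x%:R] * (cheb k).[x%:R] = 0.
Proof.
move=> sq; rewrite sum_cheb iter_diff0 //.
by rewrite big1 ?mulr0 // => x _; rewrite hornerC mul0r.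
Qed.

Let sum_weight k : \sum_(x < N) (cheb_weight k).[(x + k)%:R] =
  (-1) ^+ k * (k`! ^ 2 * 'C(N + k, k.*2.+1))%N%:R.
Proof.
have wE (x : 'I_N) : (cheb_weight k).[(x + k)%:R] =
    (-1) ^+ k * (k`! ^ 2)%N%:R * ('C(x + k, k) * 'C(N.-1 - x, k))%N%:R.
  rewrite /cheb_weight hornerM -/(falling rat k) horner_falling -bin_ffact.
  rewrite horner_prod.
  have -> : \prod_(i < k) ('X - (N + i)%:R%:P).[(x + k)%:R] =
      (-1) ^+ k * (falling rat k).[(N.-1 - x)%:R].
    rewrite /falling horner_prod (reindex_inj rev_ord_inj) /= -[X in (-1) ^+ X]card_ord -prodrN.
    apply: eq_bigr => i _; rewrite !hornerXsubC.
    have [xN ik] : (x < N)%N /\ (i < k)%N by [].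
    have -> : (N + (k - i.+1) = (N.-1 - x) + (k - i) + x)%N by lia.
    by rewrite !natrD (natrB _ (ltnW ik)); ring.
  by rewrite horner_falling -bin_ffact -mulnn !natrM; ring.
rewrite (eq_bigr _ (fun x _ => wE x)) -mulr_sumr natrM mulrA; congr (_ * _).
rewrite -natr_sum; congr (_%:R).
case: (N) => [|N']; first by rewrite big_ord0 bin_small //; lia.
transitivity (\sum_(x < (N' + k).+1) 'C(x, k) * 'C(N' + k - x, k))%N.
  rewrite -(big_mkord xpredT (fun x => 'C(x, k) * 'C(N' + k - x, k))%N).
  rewrite (big_cat_nat _ (n := k)) //=; last by lia.
  rewrite [X in _ = (X + _)%N]big_nat_cond [X in _ = (X + _)%N]big1 ?add0n; last first.
    by move=> x /andP[/andP[_ xk] _]; rewrite bin_small.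
  rewrite (big_addn 0 _ k) -addSn addnK big_mkord; apply: eq_bigr => x _.
  by rewrite subnDr.
by rewrite sum_bin_bin addnn.
Qed.

(** Summation by parts puts [k] differences on one factor, which makes it the constant [k!]; what
    remains is the sum of the weight, a convolution of binomials. *)
Lemma cheb_normE k : \sum_(x < N) (cheb k).[x%:R] ^+ 2 = cheb_norm k.
Proof.
under eq_bigr => x _ do rewrite expr2.
have [sz _] := cheb_monic k.
have [s c] := @iter_diffP k 0 (cheb k) (eq_leq sz).
have cst x : (iter k diff (cheb k)).[x] = k`!%:R.
  by rewrite (size1_polyC s) hornerC c !add0n cheb_lead mulr1 ffactnn.
rewrite sum_cheb; under eq_bigr => x _ do rewrite cst.
rewrite -mulr_sumr sum_weight /cheb_norm; set B := 'C(_, _).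
have -> : (k`! ^ 4 * B = k`! * k`! * (k`! ^ 2 * B))%N by rewrite !expnS expn0 !muln1 !mulnA.
have sq : (-1) ^+ k * (-1) ^+ k = 1 :> rat by rewrite -expr2 sqrr_sign.
by rewrite !natrM -[RHS]mul1r -[X in _ = X * _]sq; ring.
Qed.

Let size_cheb_sub k q : (size q <= k.+1)%N -> (size (q - q`_k *: cheb k)%R <= k)%N.
Proof.
move=> sq; have [sz _] := cheb_monic k.
apply/leq_sizeP => j kj; rewrite coefB coefZ.
case: (eqVneq j k) => [->|ne]; first by rewrite cheb_lead mulr1 subrr.
have lt : (k < j)%N by rewrite ltn_neqAle eq_sym ne.
by rewrite [q`_j]nth_default ?(leq_trans sq) // [(cheb k)`_j]nth_default ?sz // mulr0 subrr.
Qed.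

Lemma cheb_proj k q : (size q <= k.+1)%N ->
  \sum_(x < N) q.[x%:R] * (cheb k).[x%:R] = q`_k * cheb_norm k.
Proof.
move=> sq; have := cheb_orth_low (size_cheb_sub sq).
under eq_bigr => x _ do rewrite hornerD hornerN hornerZ mulrBl -mulrA -expr2.
by rewrite sumrB -mulr_sumr cheb_normE => /eqP; rewrite subr_eq0 => /eqP.
Qed.

Lemma cheb_orth j k : \sum_(x < N) (cheb j).[x%:R] * (cheb k).[x%:R] =
  if j == k then cheb_norm k else 0.
Proof.
case: (ltngtP j k) => [lt|gt|->].
- by apply: cheb_orth_low; rewrite (cheb_monic j).1.
- under eq_bigr => x _ do rewrite mulrC.
  by apply: cheb_orth_low; rewrite (cheb_monic k).1.
- by rewrite cheb_proj ?cheb_lead ?mul1r // (cheb_monic k).1.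
Qed.

Lemma cheb_norm_neq0 k : (k < N)%N -> cheb_norm k != 0.
Proof.
move=> kN; rewrite /cheb_norm mulf_neq0 ?invr_eq0 ?fact_rat_neq0 //.
by rewrite pnatr_eq0 -lt0n muln_gt0 expn_gt0 fact_gt0 bin_gt0; lia.
Qed.

Lemma cheb_sym k (x : rat) : (cheb k).[N%:R - 1 - x] = (-1) ^+ k * (cheb k).[x].
Proof.
have flip (y y' c d : rat) : y' + y = c + d + k%:R - 1 ->
    \prod_(i < k) (y' - (c + i%:R)) = (-1) ^+ k * \prod_(i < k) (y - (d + i%:R)).
  move=> E; rewrite [LHS](reindex_inj rev_ord_inj) /= -[X in (-1) ^+ X]card_ord -prodrN.
  apply: eq_bigr => i _; rewrite natrB // -natr1.
  have -> : y' = c + d + k%:R - 1 - y by rewrite -E addrK.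
  by ring.
have wE z : (cheb_weight k).[z] =
    \prod_(i < k) (z - (0 + i%:R)) * \prod_(i < k) (z - (N%:R + i%:R)).
  rewrite hornerM !horner_prod; congr (_ * _); apply: eq_bigr => i _.
    by rewrite hornerXsubC add0r.
  by rewrite hornerXsubC natrD.
have wsym y : (cheb_weight k).[(N + k)%:R - 1 - y] = 1 * (cheb_weight k).[y].
  have f1 : (N + k)%:R - 1 - y + y = 0 + N%:R + k%:R - 1 by rewrite natrD; ring.
  have f2 : (N + k)%:R - 1 - y + y = N%:R + 0 + k%:R - 1 by rewrite natrD; ring.
  rewrite !wE (flip y _ 0 N%:R f1) (flip y _ N%:R 0 f2).
  have sq : (-1) ^+ k * (-1) ^+ k = 1 :> rat by rewrite -expr2 sqrr_sign.
  by rewrite mulrACA sq; congr (_ * _); rewrite mulrC.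
have := horner_iter_diff_sym k wsym x.
have -> : (N + k)%:R - 1 - k%:R - x = N%:R - 1 - x :> rat by rewrite natrD; ring.
by move=> E; rewrite /cheb !hornerZ E; ring.
Qed.

Lemma cheb_center_odd k : odd k -> (cheb k).[(N%:R - 1) / 2] = 0.
Proof.
move=> ok; have := cheb_sym k ((N%:R - 1) / 2).
have -> : N%:R - 1 - (N%:R - 1) / 2 = (N%:R - 1) / 2 :> rat by field.
by rewrite -signr_odd ok expr1 mulN1r; lra.
Qed.

(** The defect [r] of the recurrence has degree at most k + 1. It is orthogonal to degrees at most
    k, by the choice of [beta], and to [cheb k.+1], by symmetry; hence it is orthogonal to itself
    and vanishes at the points of the support. *)
Lemma cheb_recurrence k (x : 'I_N) : (k < N)%N ->
  (cheb k.+2).[x%:R] = (x%:R - (N%:R - 1) / 2) * (cheb k.+1).[x%:R]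
                       - cheb_norm k.+1 / cheb_norm k * (cheb k).[x%:R].
Proof.
move=> kN; set beta := cheb_norm k.+1 / cheb_norm k.
pose y : {poly rat} := 'X - ((N%:R - 1) / 2)%:P.
pose r := cheb k.+2 - y * cheb k.+1 + beta *: cheb k.
have [s2 m2] := cheb_monic k.+2; have [s1 m1] := cheb_monic k.+1; have [s0 m0] := cheb_monic k.
have ym : y \is monic by apply: monicXsubC.
have sy : size y = 2 by apply: size_XsubC.
have syc : size (y * cheb k.+1) = k.+3.
  by rewrite size_monicM // ?monic_neq0 // sy s1.
have sr : (size r <= k.+2)%N.
  apply/leq_sizeP => j kj; rewrite coefD coefZ [(cheb k)`_j]nth_default ?s0; last by lia.
  rewrite mulr0 addr0 coefB; case: (eqVneq j k.+2) => [->|ne].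
    have /monicP : y * cheb k.+1 \is monic by rewrite rpredM.
    by rewrite lead_coefE syc => ->; rewrite cheb_lead subrr.
  by rewrite !nth_default ?subrr ?syc ?s2 //; lia.
have rE q : \sum_(x < N) q.[x%:R] * r.[x%:R] =
     \sum_(x < N) q.[x%:R] * (cheb k.+2).[x%:R]
     - \sum_(x < N) (y * q).[x%:R] * (cheb k.+1).[x%:R]
     + beta * \sum_(x < N) q.[x%:R] * (cheb k).[x%:R].
  rewrite mulr_sumr -sumrB -big_split /=; apply: eq_bigr => z _.
  by rewrite !(hornerD, hornerN, hornerM, hornerZ); ring.
have orth_low q : (size q <= k.+1)%N -> \sum_(x < N) q.[x%:R] * r.[x%:R] = 0.
  move=> sq; rewrite rE cheb_orth_low; last by lia.
  have sqy : (size (y * q)%R <= k.+2)%N.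
    by rewrite (leq_trans (size_polyMleq _ _)) // sy; lia.
  rewrite (cheb_proj sqy) (cheb_proj sq) /y mulrBl coefB coefXM coefCM /=.
  rewrite [q`_k.+1]nth_default // mulr0 subr0 sub0r /beta.
  by field; apply: cheb_norm_neq0.
have orth_mid : \sum_(x < N) (cheb k.+1).[x%:R] * r.[x%:R] = 0.
  rewrite rE cheb_orth_low ?s1 // [X in beta * X](_ : _ = 0) ?mulr0 ?addr0 ?sub0r; last first.
    by rewrite cheb_orth gtn_eqF.
  (* The summand is odd under reflection in the centre: the linear factor changes sign and the
     square of [cheb k.+1] does not. *)
  set S := \sum_(x < N) _; suff : S = - S by lra.
  rewrite {1}/S (reindex_inj rev_ord_inj) -sumrN; apply: eq_bigr => z _ /=.
  have -> : (N - z.+1)%:R = N%:R - 1 - z%:R :> rat by rewrite natrB // -natr1; ring.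
  rewrite /y !hornerM !hornerXsubC !cheb_sym.
  have sq : (-1) ^+ k.+1 * (-1) ^+ k.+1 = 1 :> rat by rewrite -expr2 sqrr_sign.
  set e := (-1) ^+ k.+1 in sq *; set u := (cheb k.+1).[_].
  transitivity ((e * e) * ((N%:R - 1 - z%:R - (N%:R - 1) / 2) * u * u)); first by ring.
  by rewrite sq; field.
have r2 : \sum_(x < N) r.[x%:R] ^+ 2 = 0.
  have := orth_low _ (size_cheb_sub sr).
  under eq_bigr => z _ do rewrite hornerD hornerN hornerZ mulrBl -mulrA -expr2.
  by rewrite sumrB -mulr_sumr orth_mid mulr0 subr0.
have /eqP : r.[x%:R] ^+ 2 = 0.
  by apply: (psumr_eq0P _ r2) => // z _; apply: sqr_ge0.
rewrite sqrf_eq0 /r !(hornerD, hornerN, hornerM, hornerZ) hornerX hornerC => /eqP r0.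
by apply/eqP; rewrite -subr_eq0 -[X in _ == X]r0; apply/eqP; ring.
Qed.

End Chebyshev.

(** * Evaluation of the product and of the sum *)

Ltac neq0 := repeat (apply/andP; split); try by []; apply: lt0r_neq0; lra.

Lemma prod_even_odd (R : comPzRingType) (f : nat -> R) (n : nat) :
  \prod_(j < n.*2) f j = \prod_(k < n) (f k.*2 * f k.*2.+1).
Proof.
elim: n => [|n IH]; first by rewrite !big_ord0.
by rewrite doubleS !big_ord_recr /= IH mulrA.
Qed.

(** After cancellation, the factorials of 0, ..., 2a - 1 are multiplied on one side by halves and on
    the other by parity. *)
Lemma prod_gram_base (a : nat) :
  \prod_(k < a) ((k`! ^ 2 * 'C(a + k, k.*2.+1))%N%:R / (2 * k)`!%:R) = 1 :> rat.
Proof.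
have E (k : 'I_a) : (k`! ^ 2 * 'C(a + k, k.*2.+1))%N%:R / (2 * k)`!%:R =
    (k`!%:R * (a + k)`!%:R) * k`!%:R / ((k.*2`!%:R * k.*2.+1`!%:R) * (rev_ord k)`!%:R) :> rat.
  have ka : (k < a)%N by [].
  have le : (k.*2.+1 <= a + k)%N by lia.
  have subE : (a + k - k.*2.+1 = rev_ord k)%N by rewrite /=; lia.
  rewrite -(bin_fact le) subE -mulnn !natrM mul2n.
  by field; rewrite !fact_rat_neq0 nat1r pnatr_eq0.
rewrite (eq_bigr _ (fun k _ => E k)) big_split /= prodfV !big_split /=.
have -> : \prod_(k < a) (a - k.+1)`!%:R = \prod_(k < a) k`!%:R :> rat.
  by rewrite [RHS](reindex_inj rev_ord_inj).
have -> : (\prod_(k < a) k`!%:R) * \prod_(k < a) (a + k)`!%:R =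
   (\prod_(k < a) k.*2`!%:R) * \prod_(k < a) k.*2.+1`!%:R :> rat.
  rewrite -[RHS]big_split /= -(prod_even_odd (fun j => j`!%:R)) -addnn.
  by rewrite big_split_ord.
by apply: divff; rewrite !mulf_neq0 //; apply/prodf_neq0 => i _; apply: fact_rat_neq0.
Qed.

(** The right side is the product of [|p_k|^2 / k!^2]. By induction on [c]: the new factor of [P]
    telescopes in [j], and, with the order of its denominators reversed, it is the product of the
    ratios of consecutive binomials. *)
Lemma MacMahon_gram (a c : nat) :
  P a a c = \prod_(k < a) ((k`! ^ 2 * 'C(a + c + k, k.*2.+1))%N%:R / (2 * k)`!%:R).
Proof.
elim: c => [|c IH].
  under eq_bigr => k _ do rewrite addn0.
  rewrite prod_gram_base /P; do 2![rewrite big1 // => ? _].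
  by rewrite big_geq.
have tele (i b : nat) : (0 < i)%N ->
    \prod_(1 <= j < b.+1) (((i + j + c.+1)%:R - 1) / ((i + j + c.+1)%:R - 2)) =
    (i + b + c)%:R / (i + c)%:R :> rat.
  move=> i_gt0; have ic (l : nat) : (i + l + c)%:R != 0 :> rat by rewrite pnatr_eq0; lia.
  elim: b => [|b IHb].
    by rewrite big_geq // addn0 divff //; have := ic 0%N; rewrite addn0.
  rewrite big_nat_recr //= IHb.
  have -> : (i + b.+1 + c.+1 = (i + b + c).+2)%N by lia.
  have -> : (i + b.+1 + c = (i + b + c).+1)%N by lia.
  have e1 : (i + b + c).+2%:R - 1 = (i + b + c).+1%:R :> rat by rewrite -!natr1; ring.
  have e2 : (i + b + c).+2%:R - 2 = (i + b + c)%:R :> rat by rewrite -!natr1; ring.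
  rewrite e1 e2; move: (ic b) (ic 0%N); rewrite addn0.
  move: (_.+1%:R) ((i + b + c)%:R) ((i + c)%:R) => x y z y0 z0.
  by field; rewrite y0 z0.
have -> : P a a c.+1 = P a a c *
    \prod_(1 <= i < a.+1) \prod_(1 <= j < a.+1)
       (((i + j + c.+1)%:R - 1) / ((i + j + c.+1)%:R - 2)).
  rewrite /P -big_split /=; apply: eq_bigr => i _; rewrite -big_split /=; apply: eq_bigr => j _.
  by rewrite big_nat_recr.
have -> : \prod_(1 <= i < a.+1) \prod_(1 <= j < a.+1)
       (((i + j + c.+1)%:R - 1) / ((i + j + c.+1)%:R - 2)) =
    \prod_(1 <= i < a.+1) ((i + a + c)%:R / (i + c)%:R) :> rat.
  by apply: eq_big_nat => i /andP[i_gt0 _]; apply: tele.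
rewrite big_add1 /= big_mkord big_split /= prodfV [X in _ * (_ / X)](reindex_inj rev_ord_inj) /=.
rewrite -prodfV -big_split /= IH -big_split /=; apply: eq_bigr => k _.
have ka : (k < a)%N by [].
have bin : ((a + c.+1 + k) * 'C(a + c + k, k.*2.+1) =
            (a - k + c) * 'C(a + c.+1 + k, k.*2.+1))%N.
  have -> : (a + c + k = (a + c.+1 + k).-1)%N by lia.
  by rewrite mul_bin_down; congr (_ * _)%N; lia.
have -> : ((a - k.+1).+1 + c = a - k + c)%N by lia.
have -> : (k.+1 + a + c = a + c.+1 + k)%N by lia.
have d0 : (a - k + c)%:R != 0 :> rat by rewrite pnatr_eq0; lia.
have uE : 'C(a + c.+1 + k, k.*2.+1)%:R =
    (a + c.+1 + k)%:R * 'C(a + c + k, k.*2.+1)%:R / (a - k + c)%:R :> rat.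
  by rewrite -natrM bin natrM mulrC mulKf.
rewrite !natrM uE; move: (_ + k)%:R (_ + c)%:R^-1 => x y.
by ring.
Qed.

(** * Values at the centre and the matching with [Q] *)

Lemma cheb_norm_ratio (N k : nat) : (k < N)%N ->
  cheb_norm N k.+1 / cheb_norm N k =
  k.+1%:R ^+ 2 * ((N + k.+1)%:R * (N - k.+1)%:R) / (4 * (2 * k + 1) * (2 * k + 3))%N%:R.
Proof.
move=> kN.
have bin : ((k.*2 + 3) * ((k.*2 + 2) * 'C(N + k.+1, k.+1.*2.+1)) =
            (N + k.+1) * ((N - k.+1) * 'C(N + k, k.*2.+1)))%N.
  have -> : (k.+1.*2.+1 = k.*2.+3)%N by lia.
  have -> : (k.*2 + 3 = k.*2.+3)%N by lia.
  have -> : (k.*2 + 2 = k.*2.+2)%N by lia.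
  rewrite mulnCA -mul_bin_diag mulnCA; congr (_ * _)%N.
  by rewrite addnS /= mul_bin_left; congr (_ * _)%N; lia.
have b0 : 'C(N + k, k.*2.+1)%:R != 0 :> rat by rewrite pnatr_eq0 -lt0n bin_gt0; lia.
have := congr1 (fun x : nat => x%:R : rat) bin; rewrite /= !natrM => binR.
have E : 'C(N + k.+1, k.+1.*2.+1)%:R = (N + k.+1)%:R * ((N - k.+1)%:R * 'C(N + k, k.*2.+1)%:R)
   / ((k.*2 + 3)%:R * (k.*2 + 2)%:R) :> rat.
  rewrite -binR; field.
  by rewrite -!natrD -?mul2n !pnatr_eq0; lia.
have -> : cheb_norm N k.+1 =
    (k.+1%:R * k`!%:R) ^+ 4 * 'C(N + k.+1, k.+1.*2.+1)%:R
     / ((2 * k).+2%:R * ((2 * k).+1%:R * (2 * k)`!%:R)).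
  rewrite /cheb_norm natrM natrX factS natrM.
  have -> : (2 * k.+1 = (2 * k).+2)%N by lia.
  by rewrite !factS !natrM.
have -> : cheb_norm N k = k`!%:R ^+ 4 * 'C(N + k, k.*2.+1)%:R / (2 * k)`!%:R.
  by rewrite /cheb_norm natrM natrX.
rewrite E -!mul2n; move: b0 (fact_rat_neq0 k) (fact_rat_neq0 (2 * k)).
rewrite -mul2n.
move: (N + k.+1)%:R (N - k.+1)%:R ('C(_, _)%:R) (k`!%:R) ((2 * k)`!%:R) => A B C D F C0 D0 F0.
have k0 : 0 <= k%:R :> rat by rewrite ler0n.
by field; rewrite F0 C0 D0 /=; neq0.
Qed.

(** At the centre the linear coefficient of the recurrence is zero, so each even value is a multiple
    of the previous one. The weight depends only on [m + j], so the induction passes from (m + 1, j)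
    to (m, j + 1). *)
Lemma cheb_center (m j : nat) :
  (cheb (2 * (m + j)).+1 (2 * j)).[(m + j)%:R] =
  (-1) ^+ j * ((2 * j)`!%:R ^+ 3 * (m + 2 * j)`!%:R) / (j`!%:R ^+ 2 * m`!%:R * (4 * j)`!%:R).
Proof.
elim: j m => [|j IH] m.
  rewrite !muln0 !addn0 /cheb muln0 /= /cheb_weight !big_ord0 mulr1 hornerZ hornerC fact0.
  by field; apply: fact_rat_neq0.
have lt : (m + j.+1 < (2 * (m + j.+1)).+1)%N by lia.
have := @cheb_recurrence (2 * (m + j.+1)).+1 (2 * j) (Ordinal lt).
have -> : (2 * j).+2 = (2 * j.+1)%N by lia.
move=> -> /=; last by lia.
have -> : (m + j.+1)%:R - ((2 * (m + j.+1)).+1%:R - 1) / 2 = 0 :> rat.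
  by rewrite -natr1 natrM; field.
rewrite mul0r sub0r cheb_norm_ratio; last by lia.
rewrite -(addSnnS m j) IH.
have -> : (m.+1 + 2 * j = (m + 2 * j).+1)%N by lia.
have -> : (m + 2 * j.+1 = (m + 2 * j).+2)%N by lia.
have -> : (2 * j.+1 = (2 * j).+2)%N by lia.
have -> : (4 * j.+1 = (4 * j).+4)%N by lia.
have -> : ((2 * (m.+1 + j)).+1 + (2 * j).+1 = 2 * (m + 2 * j + 2))%N by lia.
have -> : ((2 * (m.+1 + j)).+1 - (2 * j).+1 = 2 * m.+1)%N by lia.
have -> : (4 * (2 * (2 * j) + 1) * (2 * (2 * j) + 3) = 4 * ((4 * j).+1 * (4 * j).+3))%N by lia.
rewrite !factS [(-1) ^+ j.+1]exprS !natrM.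
move: (fact_rat_neq0 m) (fact_rat_neq0 j) (fact_rat_neq0 (2 * j)) (fact_rat_neq0 (4 * j)).
move: m`!%:R j`!%:R (2 * j)`!%:R (4 * j)`!%:R (m + 2 * j)`!%:R => a b c d e a0 b0 c0 d0.
have j0 : 0 <= j%:R :> rat by rewrite ler0n.
have m0 : 0 <= m%:R :> rat by rewrite ler0n.
move: ((-1) ^+ j) => s.  field; rewrite a0 b0 d0 /=; neq0.
Qed.

(** The summand of degree [2 * n] at the centre [m + n], as [cheb_center_term] shows. *)
Definition center_term (m n : nat) : rat :=
  (4 * n + 1)%:R * (2 * n)`!%:R ^+ 2 * (2 * m)`!%:R * (m + 2 * n)`!%:R ^+ 2
  / (n`!%:R ^+ 4 * m`!%:R ^+ 2 * (2 * m + 4 * n + 1)`!%:R).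

Lemma cheb_center_term (m j : nat) :
  (cheb (2 * (m + j)).+1 (2 * j)).[(m + j)%:R] ^+ 2 / cheb_norm (2 * (m + j)).+1 (2 * j) =
  center_term m j.
Proof.
have le : ((2 * j).*2.+1 <= (2 * (m + j)).+1 + 2 * j)%N by lia.
have := bin_fact le.
have -> : ((2 * (m + j)).+1 + 2 * j - (2 * j).*2.+1 = 2 * m)%N by lia.
have -> : ((2 * j).*2.+1 = (4 * j).+1)%N by lia.
have -> : ((2 * (m + j)).+1 + 2 * j = 2 * m + 4 * j + 1)%N by lia.
move=> /(congr1 (GRing.natmul (1 : rat))); rewrite natrM [X in _ * X]natrM => binR.
have CE : 'C(2 * m + 4 * j + 1, (4 * j).+1)%:R =
    (2 * m + 4 * j + 1)`!%:R / ((4 * j).+1`!%:R * (2 * m)`!%:R) :> rat.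
  by rewrite -binR mulfK // mulf_neq0 // fact_rat_neq0.
rewrite cheb_center /cheb_norm /center_term.
have -> : ((2 * (m + j)).+1 + 2 * j = 2 * m + 4 * j + 1)%N by lia.
have -> : ((2 * j).*2.+1 = (4 * j).+1)%N by lia.
have -> : (2 * (2 * j) = 4 * j)%N by lia.
rewrite natrM natrX CE factS natrM.
move: (fact_rat_neq0 m) (fact_rat_neq0 j) (fact_rat_neq0 (2 * j)) (fact_rat_neq0 (4 * j)).
move: (fact_rat_neq0 (2 * m)) (fact_rat_neq0 (2 * m + 4 * j + 1)) (fact_rat_neq0 (m + 2 * j)).
have sq := sqrr_sign rat j; move: ((-1) ^+ j) sq => s sq.
move: m`!%:R j`!%:R (2 * j)`!%:R (4 * j)`!%:R (m + 2 * j)`!%:R => a b c d e.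
move: (2 * m)`!%:R (2 * m + 4 * j + 1)`!%:R => f g f0 g0 e0 a0 b0 c0 d0.
have j0 : 0 <= j%:R :> rat by rewrite ler0n.
rewrite !exprMn sq -natr1 natrD natrM.
field; rewrite a0 b0 c0 d0 f0 g0 /=; neq0.
Qed.

(* The sum in Q m n, for z = m + n.                                            *)
Definition Qsum (z n : nat) : rat :=
  \sum_(0 <= i < n) (-1) ^+ (n - i - 1) / (2 * n - 2 * i - 1)%:R
      * (shifted_factorial (z - i)%:R (2 * i) / (i`! ^ 2)%:R).

Lemma shifted_factorialS (x k : nat) :
  shifted_factorial x%:R (2 * k.+1) =
  x%:R * shifted_factorial x.+1%:R (2 * k) * (x + (2 * k).+1)%:R.
Proof.
have -> : (2 * k.+1 = (2 * k).+2)%N by lia.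
rewrite /shifted_factorial big_ord_recr big_ord_recl /= addr0 natrD; congr (_ * _ * _).
by apply: eq_bigr => i _; rewrite /bump /= add1n -!natr1; ring.
Qed.

Lemma QsumS (z n : nat) : (n < z)%N ->
  (2 * n + 1)%:R ^+ 2 * Qsum z n.+1 =
  ((2 * z - 1)%:R ^+ 2 - (2 * n)%:R ^+ 2) * Qsum z n +
  (4 * n + 1)%:R * (shifted_factorial (z - n)%:R (2 * n) / n`!%:R ^+ 2).
Proof.
move=> nz.
pose c i : rat := shifted_factorial (z - i)%:R (2 * i) / i`!%:R ^+ 2.
(* The certificate of creative telescoping.                                    *)
pose G i : rat := - 4 * i%:R ^+ 2 * c i * (-1) ^+ (n + i) / (2 * n%:R - 2 * i%:R + 1).
have cS i : (i.+1 < z)%N -> i.+1%:R ^+ 2 * c i.+1 = (z%:R - 1 - i%:R) * (z%:R + i%:R) * c i.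
  move=> iz; rewrite /c shifted_factorialS.
  have -> : ((z - i.+1).+1 = z - i)%N by lia.
  have -> : (z - i.+1 + (2 * i).+1 = z + i)%N by lia.
  rewrite natrB ?(ltnW iz) // natrD -natr1 factS natrM -natr1.
  move: (fact_rat_neq0 i) (shifted_factorial _ _) => f0 x.
  have i0 : 0 <= i%:R :> rat by rewrite ler0n.
  by field; rewrite f0 /=; neq0.
have sgn i : (i < n)%N -> (-1) ^+ (n - i) = (-1) ^+ (n + i) :> rat.
  by move=> lt; rewrite -signr_odd oddB ?(ltnW lt) // -oddD signr_odd.
have sumG : \sum_(0 <= i < n) (G i.+1 - G i) = - 4 * n%:R ^+ 2 * c n.
  rewrite telescope_sumr // /G mulr0n expr0n /= mulr0 !mul0r subr0 addnn -signr_odd odd_double.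
  by rewrite subrr add0r divr1 mulr1.
(* Term by term the combination is [G i.+1 - G i]; the summand [i = n] of [Qsum z n.+1] is added at
   the end. *)
have key : (2 * n + 1)%:R ^+ 2 * \sum_(0 <= i < n) (-1) ^+ (n.+1 - i - 1) / (2 * n.+1 - 2 * i - 1)%:R * c i
     - ((2 * z - 1)%:R ^+ 2 - (2 * n)%:R ^+ 2) *
       \sum_(0 <= i < n) (-1) ^+ (n - i - 1) / (2 * n - 2 * i - 1)%:R * c i = - 4 * n%:R ^+ 2 * c n.
  rewrite -sumG !mulr_sumr -sumrB; apply: eq_big_nat => i /andP[_ ilt].
  have -> : G i.+1 = - 4 * ((z%:R - 1 - i%:R) * (z%:R + i%:R) * c i) * (-1) ^+ (n + i.+1)
      / (2 * n%:R - 2 * i.+1%:R + 1).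
    have iz : (i.+1 < z)%N by lia.
    by rewrite -(cS i iz) /G !mulrA.
  rewrite /G.
  have -> : (n.+1 - i - 1 = n - i)%N by lia.
  have dE : (n - i - 1)%:R = n%:R - i%:R - 1 :> rat.
    by rewrite natrB ?natrB ?(ltnW ilt) //; lia.
  have -> : (2 * n.+1 - 2 * i - 1)%:R = 2 * (n%:R - i%:R) + 1 :> rat.
    have -> : (2 * n.+1 - 2 * i - 1 = 2 * (n - i - 1) + 3)%N by lia.
    by rewrite natrD natrM dE; ring.
  have -> : (2 * n - 2 * i - 1)%:R = 2 * (n%:R - i%:R) - 1 :> rat.
    have -> : (2 * n - 2 * i - 1 = 2 * (n - i - 1) + 1)%N by lia.
    by rewrite natrD natrM dE; ring.
  rewrite sgn // (addnS n i) [(-1) ^+ (n + i).+1]exprS -(sgn _ ilt).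
  have -> : (-1) ^+ (n - i) = - (-1) ^+ (n - i - 1) :> rat.
    have e : (n - i = (n - i - 1).+1)%N by lia.
    by rewrite {1}e exprS mulN1r.
  have -> : (2 * z - 1)%:R = 2 * z%:R - 1 :> rat.
    by rewrite natrB ?natrM //; lia.
  have d0 : 0 <= n%:R - i%:R - 1 :> rat by rewrite -dE ler0n.
  rewrite -[i.+1%:R]natr1; move: (c i) ((-1) ^+ (n - i - 1)) => u e.
  by field; neq0.
have cE i : shifted_factorial (z - i)%:R (2 * i) / (i`! ^ 2)%:R = c i.
  by rewrite natrX.
rewrite /Qsum; under eq_bigr => i _ do rewrite cE.
under [in RHS]eq_bigr => i _ do rewrite cE.
rewrite -/(c n) big_nat_recr //=.
have -> : (n.+1 - n - 1 = 0)%N by lia.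
have -> : (2 * n.+1 - 2 * n - 1 = 1)%N by lia.
rewrite expr0 invr1 !mul1r mulrDr; apply/eqP; rewrite -subr_eq0; apply/eqP.
move: key; set S1 := \sum_(0 <= i < n) _; set S2 := \sum_(0 <= i < n) _ => key.
rewrite [(4 * n + 1)%:R]natrD natrM.
transitivity ((2 * n + 1)%:R ^+ 2 * S1 - ((2 * z - 1)%:R ^+ 2 - (2 * n)%:R ^+ 2) * S2
   + 4 * n%:R ^+ 2 * c n); last by rewrite key; ring.
by rewrite [(2 * n + 1)%:R]natrD [(2 * n)%:R]natrM; ring.
Qed.

Lemma shifted_factorial_fact (x k : nat) :
  shifted_factorial x.+1%:R k = (x + k)`!%:R / x`!%:R.
Proof.
elim: k => [|k IH]; first by rewrite /shifted_factorial big_ord0 addn0 divff ?fact_rat_neq0.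
rewrite /shifted_factorial big_ord_recr /= -/(shifted_factorial _ _) IH addnS factS natrM.
by rewrite -natrD addSn mulrC mulrA.
Qed.

(** Both values of [Q] have the same m + n, so this is [QsumS] multiplied by the prefactors. *)
Lemma Q_step (p n : nat) : Q p.+1 n.+1 = Q p.+2 n + center_term p.+1 n.
Proof.
have QE m k : Q m k = ((2 * k)`!%:R ^+ 2 * (2 * m)`!%:R * (m + 2 * k - 1)`!%:R)
  / (2 * k`!%:R ^+ 2 * m`!%:R * (2 * m + 4 * k - 2)`!%:R) * Qsum (m + k) k.
  rewrite /Q; congr (_ / _ * _); first by rewrite natrM natrM natrX.
  by rewrite natrM natrM natrM natrX.
have nz : (n < p.+1 + n.+1)%N by lia.
have := QsumS nz; rewrite !QE.
have -> : (p.+2 + n = p.+1 + n.+1)%N by lia.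
have -> : (p.+1 + n.+1 - n = p.+2)%N by lia.
rewrite shifted_factorial_fact /center_term.
have -> : (p.+1 + 2 * n.+1 - 1 = (p.+1 + 2 * n).+1)%N by lia.
have -> : (p.+2 + 2 * n - 1 = p.+1 + 2 * n)%N by lia.
have -> : (2 * p.+1 + 4 * n.+1 - 2 = (2 * p + 4 * n).+4)%N by lia.
have -> : (2 * p.+2 + 4 * n - 2 = (2 * p + 4 * n).+2)%N by lia.
have -> : (2 * p.+1 + 4 * n + 1 = (2 * p + 4 * n).+3)%N by lia.
have -> : (2 * p.+2 = (2 * p.+1).+2)%N by lia.
have -> : (2 * n.+1 = (2 * n).+2)%N by lia.
have -> : (2 * (p.+1 + n.+1) - 1)%:R = 2 * p%:R + 2 * n%:R + 3 :> rat.
  have -> : (2 * (p.+1 + n.+1) - 1 = 2 * p + 2 * n + 3)%N by lia.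
  by rewrite natrD natrD natrM natrM.
have fS (x : nat) : x.+1`!%:R = x.+1%:R * x`!%:R :> rat by rewrite factS natrM.
rewrite (fS (2 * p + 4 * n).+3) (fS (2 * p + 4 * n).+2) (fS (p.+1 + 2 * n)%N).
rewrite (fS (2 * n).+1) (fS (2 * n)%N) (fS (2 * p.+1).+1) (fS (2 * p.+1)%N) (fS p.+1) (fS n).
have p0 : 0 <= p%:R :> rat by rewrite ler0n.
have n0 : 0 <= n%:R :> rat by rewrite ler0n.
have -> : (2 * n + 1)%:R = 2 * n%:R + 1 :> rat by rewrite natrD natrM.
have -> : (2 * n)%:R = 2 * n%:R :> rat by rewrite natrM.
have -> : (4 * n + 1)%:R = 4 * n%:R + 1 :> rat by rewrite natrD natrM.
move: (Qsum _ n.+1) (Qsum _ n) => x y E.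
have n1 : 2 * n%:R + 1 != 0 :> rat by neq0.
have -> : x = (2 * n%:R + 1) ^+ 2 * x / (2 * n%:R + 1) ^+ 2 by rewrite mulrC mulKf ?expf_neq0.
rewrite {}E.
move: (fact_rat_neq0 (2 * n)) (fact_rat_neq0 n) (fact_rat_neq0 p.+1) (fact_rat_neq0 (2 * p + 4 * n).+2).
move: (2 * n)`!%:R n`!%:R p.+1`!%:R (2 * p + 4 * n).+2`!%:R (2 * p.+1)`!%:R (p.+1 + 2 * n)`!%:R.
move=> a b c d e f a0 b0 c0 d0.
field; rewrite b0 c0 d0 /=; neq0.
Qed.

Lemma Q_sum (m n : nat) : (0 < m)%N ->
  Q m n = \sum_(j < n) center_term (m + n - 1 - j) j.
Proof.
elim: n m => [|n IH] [|m] // _; first by rewrite /Q big_geq // mulr0 big_ord0.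
rewrite Q_step big_ord_recr /= IH //; congr (_ + center_term _ _); last by lia.
by apply: eq_bigr => j _; congr center_term; lia.
Qed.

(** * Conclusion *)

Lemma sorted_enum_set (N : nat) (S : {set 'I_N}) : sorted ltn [seq val i | i <- enum S].
Proof.
have := iota_ltn_sorted 0 N; rewrite -val_enum_ord enumT sorted_map => sN.
rewrite sorted_map /enum_mem; apply: sorted_filter sN => x y z /=; exact: ltn_trans.
Qed.

(** Both sides are the Vandermonde determinant of [S]. *)
Lemma binom_det_sample (N a : nat) (c0 : 'I_N) (S : {set 'I_N}) : #|S| = a ->
  (\prod_(k < a) k`!%:R) * binom_det [seq val i | i <- enum S] =
  sample_det (fun j (x : 'I_N) => (cheb N j).[x%:R]) (fun i : 'I_a => nth c0 (enum S) i).
Proof.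
move=> cS; rewrite /binom_det /rows_det size_map -cardE cS /sample_det.
rewrite (@det_monic_basis _ _ (cheb N) (fun i => (nth c0 (enum S) i)%:R)); last 2 first.
- by move=> j; case: (cheb_monic N j).
- by move=> j; case: (cheb_monic N j).
rewrite -det_binomial; congr (_ * \det _); apply/matrixP=> i j; rewrite !mxE.
by rewrite -map_comp (nth_map c0) // -cardE cS.
Qed.

Lemma num_centered_tilings_cheb (a c : nat) (mid : 'I_(a + c)) :
  (0 < a)%N -> (a + c = (mid : nat).*2.+1)%N ->
  (num_centered_tilings a a c)%:R =
  P a a c * \sum_(k < a) (cheb (a + c) k).[mid%:R] ^+ 2 / cheb_norm (a + c) k.
Proof.
move=> a_gt0 NE; rewrite (num_centered_tilingsE a_gt0 NE) natr_sum.
set f := \prod_(k < a) k`!%:R : rat.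
have f0 : f != 0 by apply/prodf_neq0 => k _; apply: fact_rat_neq0.
transitivity (\sum_(S : {set 'I_(a + c)} | (mid \in S) && (#|S| == a))
    binom_det [seq val i | i <- enum S] ^+ 2).
  rewrite [RHS]big_mkcondr; apply: eq_bigr => S _.
  have le : (c + a <= a + c)%N by lia.
  have lt : all (ltn^~ (c + a)%N) [seq val i | i <- enum S].
    by apply/allP=> _ /mapP[i _ ->]; have := ltn_ord i => /=; lia.
  have ne : (0 < a)%N || nilp [seq val i | i <- enum S] by rewrite a_gt0.
  rewrite natrX (num_matchings_strips le (sorted_enum_set S) lt ne) size_map -cardE.
  by case: ifP => // _; rewrite expr0n.
have h0 (k : 'I_a) : cheb_norm (a + c) k != 0.
  by apply: cheb_norm_neq0; apply: ltn_addr.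
have ho (j k : 'I_a) : \sum_(x < a + c) (cheb (a + c) j).[x%:R] * (cheb (a + c) k).[x%:R] =
    if j == k then cheb_norm (a + c) k else 0 by rewrite cheb_orth.
have marked := sum_sample_det_marked (phi := fun j (x : 'I_(a + c)) => (cheb (a + c) j).[x%:R])
  h0 ho mid (fact_rat_neq0 a).
apply: (mulfI (expf_neq0 2 f0)); rewrite mulr_sumr.
rewrite (eq_bigr (fun S : {set 'I_(a + c)} => sample_det
    (fun j (x : 'I_(a + c)) => (cheb (a + c) j).[x%:R]) (fun i : 'I_a => nth mid (enum S) i) ^+ 2)).
  rewrite marked mulrA; congr (_ * _).
  rewrite MacMahon_gram /f -prodrXl -big_split /=; apply: eq_bigr => k _.
  rewrite /cheb_norm; move: (fact_rat_neq0 k) (fact_rat_neq0 (2 * k)).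
  rewrite natrM [in RHS]natrM !natrX.
  move: k`!%:R (2 * k)`!%:R ('C(_, _)%:R) => x y z x0 y0.
  by field.
by move=> S /andP[_ /eqP cS]; rewrite -exprMn (binom_det_sample mid cS).
Qed.

Theorem theorem2 (m n : nat) (hm : (0 < m)%N) (hn : (0 < n)%N) :
  (num_centered_tilings (2 * n) (2 * n) (2 * m - 1))%:R
  = Q m n * P (2 * n) (2 * n) (2 * m - 1) :> rat.
Proof.
have NE : (2 * n + (2 * m - 1) = (2 * (m + n - 1)).+1)%N by lia.
have mid_lt : (m + n - 1 < 2 * n + (2 * m - 1))%N by lia.
rewrite (num_centered_tilings_cheb (mid := Ordinal mid_lt)) /=; [|lia|lia].
rewrite mulrC; congr (_ * _); rewrite Q_sum // NE mul2n.
set N := (2 * (m + n - 1)).+1; set M := (m + n - 1)%N.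
(* Degrees are paired by parity, since the odd ones vanish at the centre. *)
have split2 (F : nat -> rat) : \sum_(k < n.*2) F k = \sum_(j < n) (F j.*2 + F j.*2.+1).
  elim: (n) => [|n' IH]; first by rewrite !big_ord0.
  by rewrite doubleS !big_ord_recr /= IH addrA.
rewrite (split2 (fun k => (cheb N k).[M%:R] ^+ 2 / cheb_norm N k)); apply: eq_bigr => j _.
have jn : (j < n)%N by [].
have ME : M = (m + n - 1 - j + j)%N by rewrite /M; lia.
have midE : (N%:R - 1) / 2 = M%:R :> rat by rewrite /N -natr1 natrM addrK mulrC mulKf.
have odd0 : (cheb N j.*2.+1).[M%:R] = 0.
  by rewrite -midE cheb_center_odd //= odd_double.
rewrite odd0 expr0n mul0r addr0 -mul2n /N -/M.
by rewrite -cheb_center_term -ME.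
Qed.
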